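(* For every integer $n$ such that $|n|>1$ and $n$ is odd, the group $H_n$ is finitely generated, non-linear, solvable, and residually $2$.
   Context: Let $\mathbb{F}_2$ be the field with two elements, $t$ an indeterminate, and let $G$ be the subgroup of $\mathrm{GL}(3,\mathbb{F}_2[t,t^{-1}])$ generated by $c=\begin{pmatrix} t & 1+t & 1+t\\ 1+t & t & 1+t\\ 1+t & 1+t & t\end{pmatrix}$ and $d=\begin{pmatrix} t&0&0\\0&1&0\\0&0&1\end{pmatrix}$. For each nonzero integer $n$, let $\rho_n$ be the injective endomorphism of $\mathrm{GL}(3,\mathbb{F}_2[t,t^{-1}])$ obtained by substituting $t\mapsto t^n$ in every matrix entry. One has $\rho_n(c)=c^n$ and $\rho_n(d)=d^n$, so $\rho_n$ restricts to an injective endomorphism $\rho_n|_G:G\to G$. Let $H_n$ be the (ascending) HNN extension of $G$ by $\rho_n|_G$, i.e. $H_n=\langle G,\tau \mid \tau g\tau^{-1}=\rho_n(g),\ g\in G\rangle$. A group is linear if it admits an injective homomorphism into $\mathrm{GL}(m,F)$ for some field $F$ and some integer $m$; non-linear means not linear. A group $\Gamma$ is residually $2$ if for every nontrivial $g\in\Gamma$ there is a homomorphism $h$ from $\Gamma$ to a finite $2$-group with $h(g)\neq 1$. *)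

(* Defs.v *)
From HB Require Import structures.
From mathcomp Require Import all_boot all_order all_algebra fraction.
From mathcomp Require Import all_fingroup pgroup.
From mathcomp Require Import generic_quotient boolp ring.

Set Implicit Arguments.
Unset Strict Implicit.
Unset Printing Implicit Defensive.

Import GRing.Theory Num.Theory.

Section GeneratedSubgroup.
Variable T : groupType.
Local Open Scope group_scope.

Definition gen (S : T -> Prop) : {pred T} := fun x =>
  `[< forall K : {pred T},
        group_closed K -> (forall s, S s -> s \in K) -> x \in K >].

Variable S : T -> Prop.

Lemma gen_group_closed : group_closed (gen S).
Proof.
split=> [|x y /asboolP xS /asboolP yS]; apply/asboolP=> K Kgrp SK.
  exact: Kgrp.1.
exact: Kgrp.2 (xS _ Kgrp SK) (yS _ Kgrp SK).
Qed.

HB.instance Definition _ :=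
  isMulClosed.Build T (gen S) (group_closedM gen_group_closed).
HB.instance Definition _ := isMul1Closed.Build T (gen S) gen_group_closed.1.
HB.instance Definition _ :=
  isInvClosed.Build T (gen S) (group_closedV gen_group_closed).

Lemma mem_gen x : S x -> x \in gen S.
Proof. by move=> Sx; apply/asboolP=> K _; apply. Qed.

Record subgroup := Subgroup { subgroup_val :> T; _ : subgroup_val \in gen S }.

HB.instance Definition _ := [isSub for subgroup_val].
HB.instance Definition _ := [Choice of subgroup by <:].
HB.instance Definition _ :=
  SubChoice_isSubGroup.Build T (gen S) subgroup gen_group_closed.

End GeneratedSubgroup.

(* The group <X | R>: words over the letters x (encoded (x, false)) and x^-1
   (encoded (x, true)), modulo the congruence generated by free cancellation
   and by the relations u = v for R u v. *)
Section PresentedGroup.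
Variable X : choiceType.

Definition word := seq (X * bool).

Definition letter_inv (a : X * bool) := (a.1, ~~ a.2).

Definition word_inv (w : word) : word := rev (map letter_inv w).

Variable R : word -> word -> Prop.

Inductive word_cong : word -> word -> Prop :=
| WCrefl u : word_cong u u
| WCsym u v : word_cong u v -> word_cong v u
| WCtrans v u w : word_cong u v -> word_cong v w -> word_cong u w
| WCcat u u' v v' :
    word_cong u u' -> word_cong v v' -> word_cong (u ++ v) (u' ++ v')
| WCcancel a : word_cong [:: a; letter_inv a] [::]
| WCrel u v : R u v -> word_cong u v.

Definition word_eqv : rel word := fun u v => `[< word_cong u v >].

Lemma word_eqv_refl : reflexive word_eqv.
Proof. by move=> u; apply/asboolP/WCrefl. Qed.

Lemma word_eqv_sym : symmetric word_eqv.
Proof. by move=> u v; apply/asboolP/asboolP; apply: WCsym. Qed.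

Lemma word_eqv_trans : transitive word_eqv.
Proof. by move=> v u w /asboolP uv /asboolP vw; apply/asboolP/(WCtrans uv). Qed.

Canonical word_eqv_equiv :=
  EquivRel word_eqv word_eqv_refl word_eqv_sym word_eqv_trans.

Local Open Scope quotient_scope.

Definition presented := {eq_quot word_eqv}.

HB.instance Definition _ : EqQuotient _ word_eqv presented :=
  EqQuotient.on presented.
HB.instance Definition _ := Choice.on presented.

Lemma letter_invK : involutive letter_inv.
Proof. by case=> x b; rewrite /letter_inv /= negbK. Qed.

Lemma word_invK : involutive word_inv.
Proof. by move=> w; rewrite /word_inv map_rev revK mapK //; apply: letter_invK. Qed.

Lemma word_mulgV w : word_cong (w ++ word_inv w) [::].
Proof.
elim: w => [|a w IHw]; first exact: WCrefl.
rewrite /word_inv /= rev_cons -cats1 -cat1s (catA w).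
apply: (WCtrans (v := [:: a] ++ [::] ++ [:: letter_inv a])).
  by apply: WCcat; [exact: WCrefl | apply: WCcat IHw (WCrefl _)].
exact: WCcancel.
Qed.

Lemma word_inv_cong u v : word_cong u v -> word_cong (word_inv u) (word_inv v).
Proof.
move=> uv; apply: (WCtrans (v := word_inv u ++ (v ++ word_inv v))).
  rewrite -[X in word_cong X _]cats0; apply: WCcat (WCrefl _) _.
  exact/WCsym/word_mulgV.
rewrite catA -[X in word_cong _ X]cat0s; apply: WCcat (WCrefl _).
apply: (WCtrans (v := word_inv u ++ word_inv (word_inv u))).
  by apply: WCcat (WCrefl _) _; rewrite word_invK; apply: WCsym.
exact: word_mulgV.
Qed.

Definition presented_of (w : word) : presented := (\pi_presented w)%qT.

Lemma presented_eq u v : word_cong u v <-> presented_of u = presented_of v.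
Proof.
by split=> [uv|/eqmodP/asboolP//]; apply/eqmodP/asboolP.
Qed.

Definition presented_mul (x y : presented) : presented :=
  presented_of (repr x ++ repr y).

Definition presented_inv (x : presented) : presented :=
  presented_of (word_inv (repr x)).

Lemma repr_cong w : word_cong (repr (presented_of w)) w.
Proof. by apply/presented_eq; rewrite /presented_of reprK. Qed.

Lemma presented_ofD u v :
  presented_mul (presented_of u) (presented_of v) = presented_of (u ++ v).
Proof. by apply/presented_eq/WCcat; apply: repr_cong. Qed.

Lemma presented_ofV u :
  presented_inv (presented_of u) = presented_of (word_inv u).
Proof. exact/presented_eq/word_inv_cong/repr_cong. Qed.

Lemma presented_mulA : associative presented_mul.
Proof.
elim/quotW=> u; elim/quotW=> v; elim/quotW=> w.
by rewrite -!/(presented_of _) !presented_ofD catA.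
Qed.

Lemma presented_mul1g : left_id (presented_of [::]) presented_mul.
Proof. by elim/quotW=> u; rewrite -!/(presented_of _) presented_ofD. Qed.

Lemma presented_mulg1 : right_id (presented_of [::]) presented_mul.
Proof. by elim/quotW=> u; rewrite -!/(presented_of _) presented_ofD cats0. Qed.

Lemma presented_mulgV :
  right_inverse (presented_of [::]) presented_inv presented_mul.
Proof.
elim/quotW=> u; rewrite -!/(presented_of _) presented_ofV presented_ofD.
exact/presented_eq/word_mulgV.
Qed.

Lemma presented_mulVg :
  left_inverse (presented_of [::]) presented_inv presented_mul.
Proof.
elim/quotW=> u; rewrite -!/(presented_of _) presented_ofV presented_ofD.
by apply/presented_eq; rewrite -{2}[u]word_invK; apply: word_mulgV.
Qed.

HB.instance Definition _ := isGroup.Build presented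
  presented_mulA presented_mul1g presented_mulg1 presented_mulVg presented_mulgV.

End PresentedGroup.

(* <G, tau | tau g tau^-1 = f g, g in G>, the ascending HNN extension of G when
   f is injective: the letter Some g is the element g of G, the letter None is
   tau, and the multiplication table of G is part of the relations. *)
Section HNN.
Variables (G : groupType) (f : {multiplicative G -> G}).

Inductive hnn_rel : word (option G) -> word (option G) -> Prop :=
| HNNmul g h :
    hnn_rel [:: (Some g, false); (Some h, false)] [:: (Some (g * h)%g, false)]
| HNNconj g :
    hnn_rel [:: (None, false); (Some g, false); (None, true)]
            [:: (Some (f g), false)].

Definition hnn := presented hnn_rel.

HB.instance Definition _ := Group.on hnn.

End HNN.

Local Open Scope ring_scope.

Section GeneralLinearGroup.
Variables (m : nat) (R : comUnitRingType).

Record GL := GLmx { GL_val :> 'M[R]_m; _ : GL_val \in unitmx }.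

HB.instance Definition _ := [isSub for GL_val].
HB.instance Definition _ := [Choice of GL by <:].

Lemma GL_unit (A : GL) : (A : 'M_m) \in unitmx. Proof. exact: valP. Qed.

Definition GL_one : GL := GLmx (unitmx1 R m).

Fact GL_mul_subproof (A B : GL) : A *m B \in unitmx.
Proof. by rewrite unitmx_mul !GL_unit. Qed.

Definition GL_mul (A B : GL) : GL := GLmx (GL_mul_subproof A B).

Fact GL_inv_subproof (A : GL) : invmx A \in unitmx.
Proof. by rewrite unitmx_inv GL_unit. Qed.

Definition GL_inv (A : GL) : GL := GLmx (GL_inv_subproof A).

Lemma GL_mulA : associative GL_mul.
Proof. by move=> A B C; apply/val_inj/mulmxA. Qed.
Lemma GL_mul1g : left_id GL_one GL_mul.
Proof. by move=> A; apply/val_inj/mul1mx. Qed.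
Lemma GL_mulg1 : right_id GL_one GL_mul.
Proof. by move=> A; apply/val_inj/mulmx1. Qed.
Lemma GL_mulVg : left_inverse GL_one GL_inv GL_mul.
Proof. by move=> A; apply/val_inj/mulVmx/GL_unit. Qed.
Lemma GL_mulgV : right_inverse GL_one GL_inv GL_mul.
Proof. by move=> A; apply/val_inj/mulmxV/GL_unit. Qed.

HB.instance Definition _ := isGroup.Build GL
  GL_mulA GL_mul1g GL_mulg1 GL_mulVg GL_mulgV.

Lemma GL_valM (A B : GL) : (A * B)%g = A *m B :> 'M_m. Proof. by []. Qed.
Lemma GL_valV (A : GL) : (A^-1)%g = invmx A :> 'M_m. Proof. by []. Qed.
Lemma GL_val1 : (1%g : GL) = 1%:M :> 'M_m. Proof. by []. Qed.

End GeneralLinearGroup.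

Section GLMap.
Variables (m : nat) (R S : comUnitRingType) (f : {rmorphism R -> S}).

Fact GL_map_subproof (A : GL m R) : map_mx f A \in unitmx.
Proof. by rewrite unitmxE det_map_mx rmorph_unit -?unitmxE ?GL_unit. Qed.

Definition GL_map (A : GL m R) : GL m S := GLmx (GL_map_subproof A).

Lemma GL_map_morph : monoid.monoid_morphism GL_map.
Proof.
by split=> [|A B]; apply: val_inj; [apply: map_mx1 | apply: map_mxM].
Qed.

HB.instance Definition _ := isUMagmaMorphism.Build _ _ GL_map GL_map_morph.

End GLMap.

(* The Laurent polynomial ring R[t, t^-1], as the subring of the fraction field
   of R[t] consisting of the p / t^k. *)
Section Laurent.
Variable R : idomainType.

Local Notation K := {fraction {poly R}}.
Local Notation tofrac := (@FracField.tofrac {poly R}).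

Definition is_laurent : {pred K} := fun x =>
  `[< exists (p : {poly R}) (k : nat), x = tofrac p / tofrac 'X ^+ k >].

Record laurent := Laurent { laurent_val :> K; _ : laurent_val \in is_laurent }.

HB.instance Definition _ := [isSub for laurent_val].
HB.instance Definition _ := [Choice of laurent by <:].

Lemma tofracX_neq0 k : tofrac 'X ^+ k != 0.
Proof. by rewrite expf_neq0 // tofrac_eq0 polyX_eq0. Qed.

Lemma is_laurent_poly p : tofrac p \in is_laurent.
Proof. by apply/asboolP; exists p, 0; rewrite divr1. Qed.

Lemma is_laurent_subring : subring_closed is_laurent.
Proof.
split=> [|x y|x y].
- by rewrite -tofrac1 is_laurent_poly.
- move=> /asboolP[p [k ->]] /asboolP[q [l ->]]; apply/asboolP.
  exists (p * 'X^l - q * 'X^k), (k + l)%N.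
  rewrite -mulNr addf_div ?tofracX_neq0 // exprD.
  by rewrite tofracB !tofracM !tofracXn mulNr.
- move=> /asboolP[p [k ->]] /asboolP[q [l ->]]; apply/asboolP.
  by exists (p * q), (k + l)%N; rewrite mulf_div exprD tofracM.
Qed.

HB.instance Definition _ :=
  GRing.SubChoice_isSubComNzRing.Build K is_laurent laurent is_laurent_subring.

Definition laurent_unit : {pred laurent} := fun x =>
  (laurent_val x != 0) && ((laurent_val x)^-1 \in is_laurent).

Definition laurent_inv (x : laurent) : laurent := insubd x (laurent_val x)^-1.

Lemma laurent_mulVx : {in laurent_unit, left_inverse 1 laurent_inv *%R}.
Proof.
move=> x /andP[x0 xV]; apply: val_inj.
by rewrite rmorphM rmorph1 /= val_insubd xV mulVf.
Qed.

Lemma laurent_unitPl (x y : laurent) : y * x = 1 -> laurent_unit x.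
Proof.
move=> /(congr1 val); rewrite rmorphM rmorph1 /= => yx1.
have x0 : laurent_val x != 0.
  by apply: contra_eq_neq yx1 => ->; rewrite mulr0 eq_sym oner_neq0.
by rewrite /laurent_unit x0 -[_^-1]mul1r -yx1 mulfK //= (valP y).
Qed.

Lemma laurent_inv_out : {in [predC laurent_unit], laurent_inv =1 id}.
Proof.
move=> x; rewrite inE /= /laurent_unit => xU; apply: val_inj.
rewrite val_insubd; case: ifP => // xV.
move: xU; rewrite unfold_in /laurent_unit xV andbT negbK => /eqP.
by move=> /= ->; rewrite invr0.
Qed.

HB.instance Definition _ := GRing.ComNzRing_hasMulInverse.Build laurent
  laurent_mulVx laurent_unitPl laurent_inv_out.

Definition laurent_poly (p : {poly R}) : laurent := Laurent (is_laurent_poly p).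

Lemma laurent_poly_zmod : zmod_morphism laurent_poly.
Proof. by move=> p q; apply: val_inj; rewrite rmorphB /= tofracB. Qed.
Lemma laurent_poly_monoid : GRing.monoid_morphism laurent_poly.
Proof.
by split=> [|p q]; apply: val_inj; rewrite /= ?rmorph1 ?rmorphM ?tofrac1 ?tofracM.
Qed.

HB.instance Definition _ :=
  GRing.isZmodMorphism.Build {poly R} laurent laurent_poly laurent_poly_zmod.
HB.instance Definition _ :=
  GRing.isMonoidMorphism.Build {poly R} laurent laurent_poly laurent_poly_monoid.

Definition laurentC : {rmorphism R -> laurent} := laurent_poly \o polyC.

Definition laurentX : laurent := laurent_poly 'X.

Lemma laurent_polyB : {morph laurent_poly : p q / p - q}.
Proof. exact: rmorphB. Qed.
Lemma laurent_polyM : {morph laurent_poly : p q / p * q}.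
Proof. exact: rmorphM. Qed.
Lemma laurent_polyXn k : laurent_poly 'X^k = laurentX ^+ k.
Proof. exact: rmorphXn. Qed.

Lemma laurentX_unit : laurentX \is a GRing.unit.
Proof.
apply/andP; split; first exact: (tofracX_neq0 1).
by apply/asboolP; exists 1, 1%N; rewrite tofrac1 div1r.
Qed.

Lemma laurent_ex (x : laurent) :
  exists pk : {poly R} * nat, x * laurentX ^+ pk.2 = laurent_poly pk.1.
Proof.
have /asboolP[p [k xE]] := valP x; exists (p, k); apply: val_inj.
by rewrite rmorphM rmorphXn /= -[LHS]/(val x * _) xE divfK ?tofracX_neq0.
Qed.

Definition laurent_num (x : laurent) : {poly R} := (projT1 (cid (laurent_ex x))).1.
Definition laurent_exp (x : laurent) : nat := (projT1 (cid (laurent_ex x))).2.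

Lemma laurent_numE x : x * laurentX ^+ laurent_exp x = laurent_poly (laurent_num x).
Proof. exact: projT2 (cid (laurent_ex x)). Qed.

(* The substitution t |-> t^n on polynomials, extended to the p / t^k; the value
   does not depend on the p and k chosen to represent x, by [laurent_substE]. *)
Definition poly_subst (n : int) (p : {poly R}) : laurent :=
  (map_poly laurentC p).[laurentX ^ n].

Definition laurent_subst (n : int) (x : laurent) : laurent :=
  poly_subst n (laurent_num x) / (laurentX ^ n) ^+ laurent_exp x.

Lemma laurentXz_unit n k : (laurentX ^ n) ^+ k \is a GRing.unit.
Proof. by rewrite unitrX // unitrXz // laurentX_unit. Qed.

Section Subst.
Variable n : int.

Lemma poly_substB : {morph poly_subst n : p q / p - q}.
Proof. by move=> p q; rewrite /poly_subst rmorphB hornerD hornerN. Qed.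
Lemma poly_substM : {morph poly_subst n : p q / p * q}.
Proof. by move=> p q; rewrite /poly_subst rmorphM hornerM. Qed.
Lemma poly_substC c : poly_subst n c%:P = laurentC c.
Proof. by rewrite /poly_subst map_polyC hornerC. Qed.
Lemma poly_substX : poly_subst n 'X = laurentX ^ n.
Proof. by rewrite /poly_subst map_polyX hornerX. Qed.
Lemma poly_substXn k : poly_subst n 'X^k = (laurentX ^ n) ^+ k.
Proof. by rewrite /poly_subst map_polyXn hornerXn. Qed.

Lemma laurent_poly_inj : injective laurent_poly.
Proof. by move=> p q /(congr1 val)/= /eqP; rewrite tofrac_eq => /eqP. Qed.

Lemma laurent_substE x p k : x * laurentX ^+ k = laurent_poly p ->
  laurent_subst n x = poly_subst n p / (laurentX ^ n) ^+ k.
Proof.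
move=> xE; apply: (mulIr (laurentXz_unit n (laurent_exp x))).
apply: (mulIr (laurentXz_unit n k)).
rewrite /laurent_subst divrK ?laurentXz_unit // mulrAC.
rewrite divrK ?laurentXz_unit // -!poly_substXn -!poly_substM.
congr poly_subst; apply: laurent_poly_inj.
by rewrite !laurent_polyM !laurent_polyXn -xE -laurent_numE mulrAC.
Qed.

Lemma laurent_subst_poly p : laurent_subst n (laurent_poly p) = poly_subst n p.
Proof. by rewrite (laurent_substE (p := p) (k := 0)) ?mulr1 // divr1. Qed.

Lemma laurent_substX : laurent_subst n laurentX = laurentX ^ n.
Proof. by rewrite laurent_subst_poly poly_substX. Qed.

Lemma laurent_subst_zmod : zmod_morphism (laurent_subst n).
Proof.
move=> x y; have := laurent_numE x; have := laurent_numE y.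
move: (laurent_num x) (laurent_exp x) (laurent_num y) (laurent_exp y).
move=> p k q l yE xE; rewrite (laurent_substE xE) (laurent_substE yE).
rewrite (laurent_substE (p := p * 'X^l - q * 'X^k) (k := k + l)); last first.
  rewrite laurent_polyB !laurent_polyM !laurent_polyXn -xE -yE.
  by rewrite mulrBl exprD -!mulrA [laurentX ^+ l * _]mulrC.
apply: (mulIr (laurentXz_unit n (k + l))).
rewrite divrK ?laurentXz_unit // poly_substB !poly_substM !poly_substXn exprD.
have := laurentXz_unit n k; have := laurentXz_unit n l.
move: (_ ^+ k) (_ ^+ l) => a b bU aU.
rewrite mulrBl; congr (_ - _); first by rewrite mulrA divrK.
by rewrite mulrCA divrK // mulrC.
Qed.

Lemma laurent_subst_monoid : GRing.monoid_morphism (laurent_subst n).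
Proof.
split=> [|x y].
  have -> : 1 = laurent_poly 1 by rewrite rmorph1.
  by rewrite laurent_subst_poly -polyC1 poly_substC.
have := laurent_numE x; have := laurent_numE y.
move: (laurent_num x) (laurent_exp x) (laurent_num y) (laurent_exp y).
move=> p k q l yE xE; rewrite (laurent_substE xE) (laurent_substE yE).
rewrite (laurent_substE (p := p * q) (k := k + l)); last first.
  by rewrite laurent_polyM -xE -yE exprD mulrACA.
by rewrite mulrACA -invrM ?laurentXz_unit // -exprD addnC poly_substM.
Qed.

HB.instance Definition _ := GRing.isZmodMorphism.Build laurent laurent
  (laurent_subst n) laurent_subst_zmod.
HB.instance Definition _ := GRing.isMonoidMorphism.Build laurent laurent
  (laurent_subst n) laurent_subst_monoid.

End Subst.
End Laurent.

Section GeneratingMatrices.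
Variable S : comUnitRingType.

(* The matrices c and d with t replaced by u. *)
Definition c_mx (u : S) : 'M[S]_3 :=
  \matrix_(i, j) (if i == j then u else 1 + u).

Definition d_mx (u : S) : 'M[S]_3 :=
  \matrix_(i, j) (if i == j then (if i == 0 then u else 1) else 0).

Lemma d_mxE u : d_mx u = diag_mx (\row_j (if j == 0 then u else 1)).
Proof. by apply/matrixP=> i j; rewrite !mxE; case: eqP => [->|]. Qed.

Lemma d_mxM : {morph d_mx : u v / u * v >-> u *m v}.
Proof.
move=> u v; rewrite !d_mxE mulmx_diag; congr diag_mx; apply/rowP=> j.
by rewrite !mxE; case: ifP; rewrite ?mulr1.
Qed.

Lemma d_mx1 : d_mx 1 = 1%:M.
Proof. by apply/matrixP=> i j; rewrite !mxE if_same; case: eqP. Qed.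

Section Char2.
Hypothesis S2 : 1 + 1 = 0 :> S.

Lemma addxx_char2 (x : S) : x + x = 0.
Proof. by rewrite -[x]mulr1 -mulrDr S2 mulr0. Qed.

Lemma c_mxE u : c_mx u = (1 + u) *: const_mx 1 + 1%:M.
Proof.
apply/matrixP=> i j; rewrite !mxE mulr1; case: eqP => _; last by rewrite addr0.
by rewrite addrAC addxx_char2 add0r.
Qed.

Lemma c_mxM : {morph c_mx : u v / u * v >-> u *m v}.
Proof.
move=> u v; pose J : 'M[S]_3 := const_mx 1.
have JJ : J *m J = J.
  apply/matrixP=> i j; rewrite !mxE !big_ord_recr big_ord0 /= !mxE.
  by rewrite !mulr1 add0r addxx_char2 add0r.
rewrite !c_mxE -/J mulmxDl !mulmxDr mul1mx !mulmx1.
rewrite -scalemxAl -scalemxAr JJ scalerA !addrA -!scalerDl.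
congr (_ *: _ + _); symmetry.
have -> : (1 + u) * (1 + v) + (1 + u) + (1 + v) =
          1 + u * v + ((1 + u) + (1 + u)) + (v + v) by ring.
by rewrite !addxx_char2 !addr0.
Qed.

Lemma c_mx1 : c_mx 1 = 1%:M.
Proof. by rewrite c_mxE addxx_char2 scale0r add0r. Qed.

End Char2.

Lemma morph_mx_unit (M : S -> 'M[S]_3) u :
    {morph M : u v / u * v >-> u *m v} -> M 1 = 1%:M ->
  u \is a GRing.unit -> M u \in unitmx.
Proof.
move=> MM M1 uU; have : M u *m M u^-1 = 1%:M by rewrite -MM divrr.
by case/mulmx1_unit.
Qed.

Lemma gen_exprz (M : S -> 'M[S]_3) (P : GL 3 S -> Prop) (u : S) (A : GL 3 S) :
    {morph M : u v / u * v >-> u *m v} -> M 1 = 1%:M ->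
    u \is a GRing.unit -> A = M u :> 'M_3 -> A \in gen P ->
  forall (n : int) (B : GL 3 S), B = M (u ^ n) :> 'M_3 -> B \in gen P.
Proof.
move=> MM M1 uU AE Agen n.
have posz k (B : GL 3 S) : B = M (u ^+ k) :> 'M_3 -> B \in gen P.
  elim: k B => [|k IHk] B BE.
    by rewrite (_ : B = 1%g) ?gpred1 //; apply: val_inj; rewrite /= BE M1.
  have -> : B = (A * (A^-1 * B))%g by rewrite mulVKg.
  apply: gpredM => //; apply: IHk.
  rewrite GL_valM BE exprS MM -AE mulmxA.
  by rewrite GL_valV mulVmx ?mul1mx // GL_unit.
case: n => [k|k] B BE; first exact: posz BE.
rewrite -gpredV; apply: (posz k.+1); rewrite GL_valV -[invmx _]mulmx1 -M1.
rewrite -(divrr (unitrX k.+1 uU)) mulrC MM mulmxA.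
by rewrite -BE mulVmx ?mul1mx // GL_unit.
Qed.

End GeneratingMatrices.

Section MapMatrices.
Variables (S T : comUnitRingType) (f : {rmorphism S -> T}).

Lemma map_c_mx u : map_mx f (c_mx u) = c_mx (f u).
Proof.
by apply/matrixP=> i j; rewrite !mxE; case: ifP; rewrite // rmorphD rmorph1.
Qed.

Lemma map_d_mx u : map_mx f (d_mx u) = d_mx (f u).
Proof.
apply/matrixP=> i j; rewrite !mxE.
by case: ifP => _; [case: ifP; rewrite ?rmorph1 | rewrite rmorph0].
Qed.

End MapMatrices.

Section GroupG.

Local Notation L := (laurent 'F_2).
Local Notation t := (laurentX 'F_2).

Lemma laurent2_char2 : 1 + 1 = 0 :> L.
Proof.
have F2 : 1 + 1 = 0 :> 'F_2 by apply: val_inj.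
by rewrite -(rmorph1 (laurentC _)) -rmorphD F2 rmorph0.
Qed.

Fact mat_c_subproof : c_mx t \in unitmx.
Proof.
apply: morph_mx_unit (laurentX_unit _); last exact: c_mx1 laurent2_char2.
exact: c_mxM laurent2_char2.
Qed.

Fact mat_d_subproof : d_mx t \in unitmx.
Proof.
apply: morph_mx_unit (laurentX_unit _); last exact: d_mx1.
exact: d_mxM.
Qed.

Definition mat_c : GL 3 L := GLmx mat_c_subproof.
Definition mat_d : GL 3 L := GLmx mat_d_subproof.

Definition cd_gen (x : GL 3 L) : Prop := x = mat_c \/ x = mat_d.

Definition groupG := subgroup cd_gen.

HB.instance Definition _ := Group.on groupG.

Fact rho_subproof (n : int) (g : groupG) :
  GL_map (laurent_subst n) (\val g) \in gen cd_gen.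
Proof.
pose K : {pred GL 3 L} := fun x => GL_map (laurent_subst n) x \in gen cd_gen.
have /asboolP gP := valP g; apply: (gP K).
  split=> [|x y xK yK]; rewrite unfold_in.
    by rewrite gmulf1 gpred1.
  by rewrite gmulfF gpredF.
have tU := laurentX_unit 'F_2.
move=> s [] ->; rewrite unfold_in.
  have cS : mat_c \in gen cd_gen by apply: mem_gen; left.
  apply: (gen_exprz (c_mxM laurent2_char2) (c_mx1 laurent2_char2) tU _ cS).
    by [].
  by rewrite -laurent_substX; apply: map_c_mx.
have dS : mat_d \in gen cd_gen by apply: mem_gen; right.
apply: (gen_exprz (@d_mxM _) (@d_mx1 _) tU _ dS); first by [].
by rewrite -laurent_substX; apply: map_d_mx.
Qed.

Definition rho (n : int) (g : groupG) : groupG := Subgroup (rho_subproof n g).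

Lemma rho_morph n : monoid.monoid_morphism (rho n).
Proof.
by split=> [|g h]; apply: val_inj; rewrite /= ?gmulf1 ?gmulfM.
Qed.

HB.instance Definition _ n :=
  isUMagmaMorphism.Build groupG groupG (rho n) (rho_morph n).

Definition groupH (n : int) := hnn (rho n).

HB.instance Definition _ n := Group.on (groupH n).

End GroupG.

Section GroupProperties.
Variable T : groupType.
Local Open Scope group_scope.

Definition finitely_generated : Prop :=
  exists s : seq T, forall x : T, x \in gen [in s].

Definition linear_group : Prop :=
  exists (F : fieldType) (m : nat) (h : {multiplicative T -> GL m F}),
    injective h.

Fixpoint derived_subgroup (k : nat) : {pred T} :=
  if k is k'.+1 then
    gen (fun z => exists x y, [/\ x \in derived_subgroup k',
                                  y \in derived_subgroup k' & z = [~ x, y]])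
  else predT.

Definition solvable_group : Prop :=
  exists k, forall x : T, x \in derived_subgroup k -> x = 1.

Definition residually_pgroup (p : nat) : Prop :=
  forall g : T, g <> 1 ->
    exists (K : finGroupType) (h : {multiplicative T -> K}),
      p.-group [set: K] /\ h g <> 1.

End GroupProperties.

(* Main.v *)
Require Import Defs.
From mathcomp Require Import all_boot all_order all_algebra.
From HB Require Import structures.
From mathcomp Require Import all_fingroup pgroup cyclic fieldext qfpoly.
From mathcomp Require Import generic_quotient boolp ring zify mxpoly qpoly.
Import Order.TTheory GRing.Theory Num.Theory.

Set Implicit Arguments.
Unset Strict Implicit.
Unset Printing Implicit Defensive.

(** Write tau for the stable letter of H = H_n and t for the variable.

Since tau g = rho(g) tau, every element of H is tau^-j g tau^l with g in G
([hnn_normal_form]). Everything is read off from this shape, from the finite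
quotients of H, and from an explicit triangular form of G.

Solvable. In the basis (0,1,1), (1,0,0), (0,1,0) the matrices c and d become
upper triangular with diagonal (1, t, 1) ([tri_mx]), so the third derived
subgroup of G is trivial ([groupG_derived3]). A commutator in H has exponent
zero in tau, hence is a conjugate of an element of G by a power of tau, and
finitely many such elements can be conjugated into G by one and the same power;
so the derived length of H is at most one more than that of G
([hnn_solvable]).

Residually 2. Let Q = F_2[X]/(X^N - 1) with N a power of 2, and s = X - 1, so
that s^N = 0 in Q. Because n is odd, the substitution X -> X^n induces a ring
endomorphism f of Q with f(x) = x modulo s and f(s) = s modulo s^2. The group G
acts on Q^3 through the reduction of its matrices, tau acts through the inverse
of the coefficientwise action of f, and c, d, f are all the identity on the
successive quotients of the filtration of Q^3 by the powers of s. Permutations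
with that property form a 2-group ([unipotent_perms_pgroup]): if p - 1 raises
the filtration by k, then p^2 - 1 raises it by 2k in characteristic 2. Letting
N grow, no nontrivial matrix of G dies in all these quotients
([finite_quotient], [GL_separated]). An element tau^-j g tau^l with j <> l is
detected in a cyclic quotient. As a by-product G embeds in H ([base_inj]).

Not linear. Let h embed H in GL_m(F).
If F has characteristic 2: A = h(c) is conjugate to A^(n^2), so its minimal
polynomial p divides p(X^(n^2)). Hence the roots of p are stable under
x -> x^(n^2); they are nonzero and finitely many, so they are roots of unity, p divides
some X^M - 1 and A has finite order ([GL_finite_order]), whereas c does not.
Otherwise: a family of m x m commuting involutions is simultaneously
diagonalizable with entries 1 and -1, so it has at most 2^m members
([commuting_involutions_bound]). But the commutators of c d^-1 with its
conjugates by the powers of d are infinitely many commuting involutions of G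
([central_comm_inj]). *)

(** * Homomorphisms out of groups given by generators *)

Section Multiplicative.
Local Open Scope group_scope.
Variables (G K : groupType) (f : {multiplicative G -> K}).

Lemma multiplicative1 : f 1 = 1.
Proof. by apply: (mulgI (f 1)); rewrite -gmulfM !mulg1. Qed.

Lemma multiplicativeV : {morph f : x / x^-1}.
Proof.
by move=> x; apply: (mulgI (f x)); rewrite -gmulfM !mulgV multiplicative1.
Qed.

Lemma multiplicativeX n : {morph f : x / x ^+ n}.
Proof.
by elim: n => [|n IHn] x; rewrite ?multiplicative1 // !expgS gmulfM IHn.
Qed.

Lemma multiplicativeR : {morph f : x y / [~ x, y]}.
Proof. by move=> x y; rewrite /commg /conjg !gmulfM !multiplicativeV. Qed.

End Multiplicative.

Section PresentedUniversal.
Local Open Scope group_scope.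
Variables (X : choiceType) (R : word X -> word X -> Prop).
Variables (K : groupType) (phi : X -> K).

Definition word_eval (w : word X) : K :=
  \prod_(a <- w) (if a.2 then (phi a.1)^-1 else phi a.1).

Hypothesis phiR : forall u v, R u v -> word_eval u = word_eval v.

Lemma word_eval_cong u v : word_cong R u v -> word_eval u = word_eval v.
Proof.
elim=> {u v} [//|//|v u w _ -> _ -> //|u u' v v' _ Eu _ Ev|[x []]|//].
- by rewrite /word_eval !big_cat /= -!/(word_eval _) Eu Ev.
- by rewrite /word_eval !big_cons !big_nil /= mulg1 mulVg.
- by rewrite /word_eval !big_cons !big_nil /= mulg1 mulgV.
Qed.

Definition presented_lift (x : presented R) : K := word_eval (repr x).

Lemma presented_liftE w : presented_lift (presented_of R w) = word_eval w.
Proof. exact/word_eval_cong/repr_cong. Qed.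

Lemma presented_liftM : {morph presented_lift : x y / x * y}.
Proof.
elim/quotW=> u; elim/quotW=> v; rewrite -!/(presented_of R _).
have -> : presented_of R u * presented_of R v = presented_of R (u ++ v).
  exact: presented_ofD.
by rewrite !presented_liftE /word_eval big_cat.
Qed.

End PresentedUniversal.

(** * Ascending HNN extensions *)

Section HNNTheory.
Local Open Scope group_scope.
Variables (G : groupType) (f : {multiplicative G -> G}).

Definition hnn_base (g : G) : hnn f :=
  presented_of (hnn_rel f) [:: (Some g, false)].
Definition hnn_stable : hnn f := presented_of (hnn_rel f) [:: (None, false)].

Local Notation tau := hnn_stable.

Lemma hnn_baseM : {morph hnn_base : g h / g * h}.
Proof.
move=> g h; symmetry; rewrite [LHS]presented_ofD; apply/presented_eq.
exact/WCrel/HNNmul.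
Qed.

HB.instance Definition _ := isMultiplicative.Build G (hnn f) hnn_base hnn_baseM.

Lemma hnn_conj g : tau * hnn_base g = hnn_base (f g) * tau.
Proof.
apply: (mulIg tau^-1); rewrite mulgK.
have -> : tau^-1 = presented_of (hnn_rel f) [:: (None, true)].
  exact: presented_ofV.
have -> : tau * hnn_base g =
          presented_of (hnn_rel f) [:: (None, false); (Some g, false)].
  exact: presented_ofD.
rewrite [LHS]presented_ofD; apply/presented_eq/WCrel/HNNconj.
Qed.

Lemma hnn_conjX k g : tau ^+ k * hnn_base g = hnn_base (iter k f g) * tau ^+ k.
Proof.
elim: k => [|k IHk]; first by rewrite !expg0 mul1g mulg1.
by rewrite iterS expgS -mulgA IHk !mulgA hnn_conj.
Qed.

(** Induction on words; the inverse of a letter of G is again a letter of G, so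
only tau needs a separate step for its inverse. *)
Lemma hnn_rect (P : hnn f -> Prop) :
    P 1 -> (forall g x, P x -> P (hnn_base g * x)) ->
    (forall x, P x -> P (tau * x)) -> (forall x, P x -> P (tau^-1 * x)) ->
  forall x, P x.
Proof.
move=> P1 PG Pt PtV; elim/quotW=> w; rewrite -/(presented_of _ w).
elim: w => [//|a w IHw].
have -> : presented_of (hnn_rel f) (a :: w) =
          presented_of (hnn_rel f) [:: a] * presented_of (hnn_rel f) w.
  by rewrite [RHS]presented_ofD.
have aV o : presented_of (hnn_rel f) [:: (o, true)] =
            (presented_of (hnn_rel f) [:: (o, false)])^-1.
  by symmetry; apply: presented_ofV.
case: a => [[g|] []]; rewrite ?aV; [|exact: PG|exact: PtV|exact: Pt].
by rewrite -/(hnn_base g) -multiplicativeV; apply: PG.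
Qed.

(** The relation tau g = f(g) tau pushes positive powers of tau to the right and
negative ones to the left; the product of tau with tau^-j g tau^l cancels one
tau if j > 0. *)
Lemma hnn_normal_form x :
  exists j g l, x = tau ^- j * hnn_base g * tau ^+ l.
Proof.
elim/hnn_rect: x => [|h x [j [g [l ->]]]|x [j [g [l ->]]]|x [j [g [l ->]]]].
- by exists 0, 1, 0; rewrite expg0 multiplicative1 invg1 !mulg1.
- exists j, (iter j f h * g), l; rewrite gmulfM !mulgA; congr (_ * _ * _).
  by apply: (mulgI (tau ^+ j)); rewrite !mulgA hnn_conjX mulgK mulgV mul1g.
- case: j => [|j].
    by exists 0, (f g), l.+1; rewrite expg0 invg1 !mul1g mulgA hnn_conj expgS mulgA.
  by exists j, g, l; rewrite expgSr invgM !mulgA mulgV mul1g.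
- by exists j.+1, g, l; rewrite expgSr invgM !mulgA.
Qed.

Section Lift.
Variables (K : groupType) (phi : {multiplicative G -> K}) (s : K).
Hypothesis phi_s : forall g, s * phi g = phi (f g) * s.

Definition hnn_letter (o : option G) : K := if o is Some g then phi g else s.

Lemma hnn_letter_rel u v :
  hnn_rel f u v -> word_eval hnn_letter u = word_eval hnn_letter v.
Proof.
case=> [g h|g]; rewrite /word_eval !big_cons !big_nil /= !mulg1 ?gmulfM //.
by rewrite mulgA phi_s mulgK.
Qed.

Definition hnn_lift : {multiplicative hnn f -> K} :=
  HB.pack (presented_lift hnn_letter : hnn f -> K)
    (isMultiplicative.Build (hnn f) K _ (presented_liftM hnn_letter_rel)).

Lemma hnn_lift_base g : hnn_lift (hnn_base g) = phi g.
Proof.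
by rewrite [LHS](presented_liftE hnn_letter_rel) /word_eval big_seq1.
Qed.

Lemma hnn_lift_stable : hnn_lift tau = s.
Proof.
by rewrite [LHS](presented_liftE hnn_letter_rel) /word_eval big_seq1.
Qed.

End Lift.

End HNNTheory.

(** * Derived series of an HNN extension *)

Section Generation.
Local Open Scope group_scope.

Lemma gen_ind (T : groupType) (S K : T -> Prop) :
    K 1 -> (forall x y, K x -> K y -> K (x * y^-1)) ->
    (forall s, S s -> K s) ->
  forall x, x \in gen S -> K x.
Proof.
move=> K1 KF SK x /asboolP/(_ (fun y => `[< K y >])) xK; apply/asboolP/xK.
  split=> [|y z /asboolP Ky /asboolP Kz]; first exact/asboolP.
  by apply/asboolP/KF.
by move=> s Ss; apply/asboolP/SK.
Qed.

End Generation.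

Section Derived.
Local Open Scope group_scope.

Lemma derived_subgroup_group (T : groupType) k :
  group_closed (@derived_subgroup T k).
Proof. by case: k => [|k] //; apply: gen_group_closed. Qed.

(** An upper bound for all derived subgroups at once: P k only has to be stable
under the group operations and to catch the commutators of P (k - 1). *)
Lemma derived_subgroup_sub (T : groupType) (P : nat -> T -> Prop) :
    (forall x, P 0 x) -> (forall k, P k 1) ->
    (forall k x y, P k x -> P k y -> P k (x * y^-1)) ->
    (forall k x y, P k x -> P k y -> P k.+1 [~ x, y]) ->
  forall k x, x \in @derived_subgroup T k -> P k x.
Proof.
move=> P0 P1 PF PR; elim=> [//|k IHk] x.
apply: (gen_ind (K := P k.+1)) => // [y z|z [a [b [aD bD ->]]]].
  exact: PF.
by apply: PR; apply: IHk.
Qed.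

Lemma derived_subgroup_morph (T U : groupType) (h : {multiplicative T -> U}) k x :
  x \in @derived_subgroup T k -> h x \in @derived_subgroup U k.
Proof.
pose P j (y : T) := h y \in @derived_subgroup U j.
have D j := derived_subgroup_group U j.
apply: (derived_subgroup_sub (P := P)) => {k x} // [k|k x y|k x y]; rewrite /P.
- by rewrite multiplicative1; apply: (D k).1.
- by rewrite gmulfM multiplicativeV; apply: (D k).2.
- by move=> Px Py; rewrite multiplicativeR /=; apply: Defs.mem_gen; exists (h x), (h y).
Qed.

Variables (G : groupType) (f : {multiplicative G -> G}).
Local Notation tau := (hnn_stable f).
Local Notation base := (hnn_base f).

(** The exponents i and l are parameters because the arguments below keep track
of them: l - i is the tau-exponent of x, and P is where g is found. *)
Definition normal_form (P : {pred G}) i l (x : hnn f) :=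
  exists2 g, g \in P & x = tau ^- i * base g * tau ^+ l.

Section ClosedPredicate.
Variable P : {pred G}.
Hypotheses (Pgrp : group_closed P) (fP : {in P, forall g, f g \in P}).

(** Inserting tau^-k tau^k around g replaces it by f^k(g); this brings two
elements to matching exponents. *)
Lemma normal_form_raise k i l x :
  normal_form P i l x -> normal_form P (i + k) (k + l) x.
Proof.
case=> g gP ->; exists (iter k f g); first by elim: k => //= k; apply: fP.
rewrite addnC !expgnDr invgM -!mulgA; congr (_ * _).
by rewrite [X in _ = _ * X]mulgA -hnn_conjX -mulgA mulKg.
Qed.

(** After raising, the inner powers of tau cancel, and the exponents of a product
are the sums of the exponents: they no longer depend on the order of the
factors. *)
Lemma normal_formM i l j m x y : normal_form P i l x -> normal_form P j m y ->
  normal_form P (i + j) (l + m) (x * y).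
Proof.
move=> /(normal_form_raise j)[g gP ->] /(normal_form_raise l)[h hP ->].
exists (g * h); first exact: (group_closedM Pgrp).
by rewrite gmulfM !mulgA mulgK.
Qed.

Lemma normal_formV i l x : normal_form P i l x -> normal_form P l i x^-1.
Proof.
case=> g gP ->; exists g^-1; first exact: (group_closedV Pgrp).
by rewrite !invgM invgK multiplicativeV mulgA.
Qed.

(** By [normal_formM], x y and y x have the same exponents, so those of
[~ x, y] = (y x)^-1 (x y) agree. *)
Lemma normal_formR i l j m x y : normal_form P i l x -> normal_form P j m y ->
  exists k, normal_form P k k [~ x, y].
Proof.
move=> xP yP; exists (m + l + (i + j)).
have -> : [~ x, y] = (y * x)^-1 * (x * y) by rewrite invgM /commg /conjg !mulgA.
have := normal_formM (normal_formV (normal_formM yP xP)) (normal_formM xP yP).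
by rewrite -(addnC l) -(addnC (l + m)) -(addnC i).
Qed.

Lemma normal_form_balance i j x y : normal_form P i i x -> normal_form P j j y ->
  normal_form P (i + j) (i + j) x /\ normal_form P (i + j) (i + j) y.
Proof.
move=> /(normal_form_raise j) xP /(normal_form_raise i) yP.
by move: xP yP; rewrite (addnC j).
Qed.

End ClosedPredicate.

(** Conjugates of elements of G by powers of tau can be brought to the same power,
so their commutators are conjugates of commutators in G; the first commutator
step is spent on making the tau-exponent vanish. *)
Lemma hnn_derived k x : x \in @derived_subgroup (hnn f) k.+1 ->
  exists i, normal_form (@derived_subgroup G k) i i x.
Proof.
have D j := derived_subgroup_group G j.
have fD j : {in @derived_subgroup G j, forall g, f g \in @derived_subgroup G j}.
  by move=> g; apply: derived_subgroup_morph.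
pose Q j y := if j is j'.+1 then exists i, normal_form (@derived_subgroup G j') i i y
              else True.
apply: (derived_subgroup_sub (P := Q)) => {k x} // [[|k]|[|k] x y|[|k] x y] //=.
- exists 0; exists 1; first exact: (D k).1.
  by rewrite multiplicative1 expg0 invg1 !mulg1.
- move=> [i xD] [j /(normal_formV (D k)) yD]; exists (i + j).
  exact: (normal_formM (D k) (fD k)).
- move=> _ _; have [i [g [l ->]]] := hnn_normal_form x.
  have [j [h [m ->]]] := hnn_normal_form y.
  by apply: (normal_formR (D 0) (fD 0) (i := i) (l := l) (j := j) (m := m));
     [exists g | exists h].
- move=> [i xD] [j yD]; exists (i + j).
  have [[g gD ->] [h hD ->]] := normal_form_balance (fD k) xD yD.
  exists [~ g, h]; first by rewrite /=; apply: Defs.mem_gen; exists g, h.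
  by rewrite -!mulgA -!(conjgE _ (tau ^+ (i + j))) -conjRg (multiplicativeR base).
Qed.

Lemma hnn_solvable k : (forall g, g \in @derived_subgroup G k -> g = 1) ->
  solvable_group (hnn f).
Proof.
move=> Gk; exists k.+1 => x /hnn_derived[i [g /Gk -> ->]].
by rewrite multiplicative1 mulg1 mulVg.
Qed.

Lemma hnn_finitely_generated (s : seq G) :
  (forall g, base g \in gen [in tau :: map base s]) ->
  finitely_generated (hnn f).
Proof.
move=> Gs; exists (tau :: map base s) => x.
have tS : tau \in gen [in tau :: map base s] by apply/Defs.mem_gen/mem_head.
elim/hnn_rect: x => [|g x xS|x xS|x xS]; first exact: gpred1.
- by apply: gpredM.
- by apply: gpredM.
- by apply: gpredM; rewrite ?gpredV.
Qed.

End Derived.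

(** * Residual p-finiteness of an HNN extension *)

Section HNNResidual.
Local Open Scope group_scope.

(** It suffices to separate the elements of the base group: tau^-j g tau^j is
conjugate to g, and tau^-j g tau^l with j <> l survives in the quotient Z/p^r
killing G, for p^r larger than j and l. *)
Lemma hnn_residually_p (p : nat) (G : groupType) (f : {multiplicative G -> G}) :
    prime p ->
    (forall g, g <> 1 ->
       exists (K : finGroupType) (h : {multiplicative hnn f -> K}),
       p.-group [set: K] /\ h (hnn_base f g) <> 1) ->
  residually_pgroup (hnn f) p.
Proof.
move=> p_pr Gres x; have [j [g [l ->]]] := hnn_normal_form x.
have [<- x1|jl _] := eqVneq j l.
  have [|K [h [pK hg]]] := Gres g.
    by move=> g1; apply: x1; rewrite g1 multiplicative1 mulg1 mulVg.
  exists K, h; split=> // hx; apply: hg; apply/eqP.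
  rewrite -(conjg_eq1 _ (h (hnn_stable f) ^+ j)) conjgE mulgA.
  by rewrite -hx !gmulfM multiplicativeV multiplicativeX.
pose M := (p ^ (maxn j l).+1)%N.
have maxM : maxn j l < M.
  by rewrite (ltn_trans (ltnSn _)) // ltn_expl // prime_gt1.
have M1 : 1 < M by rewrite -{1}(expn0 p) ltn_exp2l // prime_gt1.
(* Z/M is written multiplicatively here: s is its generator. *)
pose s : 'Z_M := Zp1.
pose one : {multiplicative G -> 'Z_M} := one_fun 'Z_M.
have s_comm g' : s * one g' = one (f g') * s.
  by rewrite mulg1 mul1g.
exists 'Z_M, (hnn_lift s_comm); split.
  by rewrite /pgroup cardsT card_ord Zp_cast // pnatX pnat_id.
rewrite !gmulfM multiplicativeV !multiplicativeX hnn_lift_base hnn_lift_stable.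
rewrite /= mulg1 => /(congr1 (fun y => s ^+ j * y)); rewrite mulVKg mulg1.
move=> /(congr1 val)/eqP; rewrite !Zp_expg /=.
rewrite Zp_cast // (modn_small M1) !mul1n !modn_small.
- by rewrite eq_sym (negPf jl).
- by rewrite (leq_ltn_trans (leq_maxl _ _) maxM).
- by rewrite (leq_ltn_trans (leq_maxr _ _) maxM).
Qed.
End HNNResidual.

(** * Matrices conjugate to a power of themselves *)

Section ConjugateToPower.
Local Open Scope ring_scope.

Lemma irreducible_divisor (F : fieldType) (p : {poly F}) : (1 < size p)%N ->
  exists2 r, irreducible_poly r & r %| p.
Proof.
have [k] := ubnP (size p); elim: k p => // k IHk p /ltnSE pk p1.
have [pirr|] := pselect (irreducible_poly p); first by exists p; rewrite ?dvdpp.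
move=> pred.
have [r [r1 rp rNp]] : exists r : {poly F}, [/\ size r != 1, r %| p & ~~ (r %= p)].
  apply: contra_notP pred => all_r; split=> // r r1 rp.
  by apply: contra_notT all_r => rNp; exists r.
have p0 : p != 0 by rewrite -size_poly_gt0 (ltn_trans _ p1).
have r0 : r != 0 by apply: contraNneq p0 => r0; rewrite -dvd0p -r0.
have rsz : (size r < size p)%N.
  by rewrite ltn_neqAle dvdp_size_eqp ?rNp ?dvdp_leq.
have [|q qirr qr] := IHk r (leq_trans rsz pk).
  by rewrite ltn_neqAle eq_sym r1 size_poly_gt0.
by exists q; rewrite // (dvdp_trans qr).
Qed.

Lemma root_dvdp (F : fieldType) (p q : {poly F}) x : p %| q -> root p x -> root q x.
Proof. by rewrite -!dvdp_XsubCl => /[swap] /dvdp_trans; apply. Qed.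

Section RootsClosedUnderPower.
Variables (F : fieldType) (p : {poly F}) (q : nat).
Hypotheses (q1 : (1 < q)%N) (p0 : ~~ root p 0) (pq : p %| p \Po 'X^q).

Let p_neq0 : p != 0.
Proof. by apply: contraNneq p0 => ->; rewrite root0. Qed.

(** Adjoin a root z of r. As p divides p(X^q), the elements z, z^q, z^(q^2), ...
are all roots of p, hence two of them coincide; z being nonzero, it is a root of
unity, so r and some X^N - 1 have a common root and r divides X^N - 1. *)
Lemma irreducible_dvd_Xn_sub1 r : irreducible_poly r -> r %| p ->
  exists2 N, (0 < N)%N & r %| 'X^N - 1.
Proof.
move=> rirr rp; have [L _ [z rz _]] := irredp_FAdjoin rirr.
pose pL := map_poly (in_alg L) p.
have pL0 : pL != 0 by rewrite map_poly_eq0.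
have pz : root pL z by apply: root_dvdp rz; rewrite dvdp_map.
have z0 : z != 0.
  apply: contraNneq p0 => zE; rewrite -(fmorph_root (in_alg L)) rmorph0 -zE.
  exact: pz.
have pzX i : root pL (z ^+ (q ^ i)).
  elim: i => [|i IHi]; first by rewrite expn0 expr1.
  have : pL %| pL \Po 'X^q by rewrite -(map_polyXn (in_alg L)) -map_comp_poly dvdp_map.
  move=> /root_dvdp/(_ IHi); rewrite /root horner_comp hornerXn -exprM.
  by rewrite -expnSr.
pose s := [seq z ^+ (q ^ i) | i <- iota 0 (size pL)].
have : ~~ uniq s.
  apply: contraFN (ltnn (size pL)) => s_uniq.
  rewrite -[X in (X < _)%N](size_iota 0) -(size_map (fun i => z ^+ (q ^ i))).
  by apply: max_poly_roots => //; apply/allP=> _ /mapP[i _ ->].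
move=> /(uniqPn 0)[i [j [ij]]]; rewrite size_map size_iota => jp.
rewrite !(nth_map 0) ?size_iota ?(ltn_trans ij) // !nth_iota ?(ltn_trans ij) //.
rewrite !add0n => zij.
have qij : (q ^ i < q ^ j)%N by rewrite ltn_exp2l.
exists (q ^ j - q ^ i)%N; first by rewrite subn_gt0.
rewrite -[_ %| _]negbK -irreducible_poly_coprime //.
apply/negP; rewrite -(coprimep_map (in_alg L)) => /coprimep_root/(_ rz)/eqP; apply.
rewrite rmorphB rmorph1 /= map_polyXn hornerD hornerN hornerXn hornerC.
apply/eqP; rewrite subr_eq0; apply/eqP.
apply: (mulfI (expf_neq0 (q ^ i) z0)).
by rewrite -exprD subnKC 1?ltnW // mulr1.
Qed.

(** Peeling off the irreducible factors one by one, multiply the exponents N and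
add the multiplicities. *)
Lemma dvd_Xn_sub1_exp : exists N M, (0 < N)%N /\ p %| ('X^N - 1) ^+ M.
Proof.
suff H r : r %| p -> exists N M, (0 < N)%N /\ r %| ('X^N - 1) ^+ M.
  by apply: H; rewrite dvdpp.
have [k] := ubnP (size r); elim: k r => // k IHk r /ltnSE rk rp.
have r0 : r != 0 by apply: contraNneq p_neq0 => r0; rewrite -dvd0p -r0.
have [r1|r1] := leqP (size r) 1.
  exists 1, 0; split=> //; rewrite expr0 dvdp1 eqn_leq r1 size_poly_gt0 r0 //.
have [s sirr sr] := irreducible_divisor r1.
have [N1 N10 sN] := irreducible_dvd_Xn_sub1 sirr (dvdp_trans sr rp).
have rE : r = (r %/ s) * s by rewrite divpK.
have [||N2 [M [N20 rN]]] := IHk (r %/ s).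
- have [s1 _] := sirr; rewrite (leq_trans _ rk) //.
  by rewrite size_divp ?ltn_subrL -?size_poly_gt0 //; lia.
- by rewrite (dvdp_trans _ rp) // {2}rE dvdp_mulr.
exists (N1 * N2)%N, M.+1; rewrite muln_gt0 N10; split=> //.
have dvd1 a b : ('X^a - 1 : {poly F}) %| 'X^(a * b) - 1.
  by rewrite exprM -{2}(expr1n _ b) subrXX dvdp_mulr.
rewrite rE exprSr dvdp_mul //; last exact: dvdp_trans (dvd1 _ _).
by rewrite (dvdp_trans rN) // dvdp_exp2r // mulnC.
Qed.

(** In characteristic 2 the power 2^M >= M of X^N - 1 is again of this form. *)
Lemma dvd_Xn_sub1 : 2%N \in [pchar F] -> exists2 N, (0 < N)%N & p %| 'X^N - 1.
Proof.
move=> F2; have [N [M [N0 pN]]] := dvd_Xn_sub1_exp.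
exists (N * 2 ^ M)%N; first by rewrite muln_gt0 N0 expn_gt0.
have c2 : [pchar {poly F}].-nat (2 ^ M)%N.
  by rewrite pnatX pnatE // pchar_poly F2.
have <- : ('X^N - 1 : {poly F}) ^+ (2 ^ M) = 'X^(N * 2 ^ M) - 1.
  by rewrite exprDn_pchar // exprNn_pchar // expr1n exprM.
by rewrite (dvdp_trans pN) // dvdp_exp2l // ltnW // ltn_expl.
Qed.

End RootsClosedUnderPower.

(** The minimal polynomial p of A annihilates the conjugate A^q of A, hence
divides p(X^q). *)
Lemma GL_finite_order (F : fieldType) m (A T : GL m F) q :
    2%N \in [pchar F] -> (1 < q)%N -> (T * A = A ^+ q * T)%g ->
  exists2 N, (0 < N)%N & (A ^+ N = 1)%g.
Proof.
case: m A T => [|m] A T F2 q1 TA.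
  by exists 1%N => //; apply/val_inj/matrixP=> -[].
have valX (B : GL m.+1 F) k : GL_val (B ^+ k)%g = GL_val B ^+ k.
  by elim: k => // k IHk; rewrite expgS exprS -IHk.
pose a : 'M_m.+1 := GL_val A; pose p := mxminpoly a.
pose t : 'M_m.+1 := GL_val T.
have ta : t * a = a ^+ q * t by rewrite /a -valX; have /(congr1 val) := TA.
have ua : a \in unitmx := Defs.GL_unit A.
have [//||||N N0] := @dvd_Xn_sub1 F p q.
- rewrite root_mxminpoly; apply: contraL ua.
  rewrite unitmxE unitfE negbK rootE horner_coef0 char_poly_det mulf_eq0.
  by rewrite signr_eq0.
- apply: mxminpoly_min.
  have -> r : horner_mx a (r \Po 'X^q) = horner_mx (a ^+ q) r.
    elim/poly_ind: r => [|r c IHr]; first by rewrite comp_poly0 !rmorph0.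
    rewrite comp_polyD comp_polyM comp_polyX comp_polyC !rmorphD !rmorphM /=.
    by rewrite IHr !horner_mx_C horner_mx_X rmorphXn /= horner_mx_X.
  have Th r : t * horner_mx a r = horner_mx (a ^+ q) r * t.
    elim/poly_ind: r => [|r c IHr]; first by rewrite !rmorph0 mulr0 mul0r.
    rewrite !rmorphD !rmorphM /= !horner_mx_C !horner_mx_X mulrDr mulrDl.
    by rewrite mulrA IHr -!mulrA ta; congr (_ + _); apply: scalar_mxC.
  by apply: (mulIr (Defs.GL_unit T)); rewrite -Th mx_root_minpoly mul0r mulr0.
- by [].
move=> /dvdpP[r rE]; exists N => //; apply: val_inj; rewrite /= valX.
apply/eqP; rewrite -subr_eq0 -/a.
have -> : a ^+ N - 1%:M = horner_mx a ('X^N - 1).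
  by rewrite rmorphB rmorphXn /= horner_mx_X (rmorph1 (horner_mx a)).
by rewrite rE rmorphM /= mx_root_minpoly mulr0.
Qed.

End ConjugateToPower.

(** * Commuting involutions *)

Section CommutingInvolutions.
Local Open Scope ring_scope.
Variables (F : fieldType).
Hypothesis F2 : 2%N \notin [pchar F].

Lemma involution_diagonalizable m (A : 'M[F]_m) : A *m A = 1%:M -> diagonalizable A.
Proof.
case: m A => [|m] A AA.
  by exists 1%:M; [apply: unitmx1 | apply/is_diag_mxP; case].
apply/diagonalizableP; exists [:: 1; -1].
  rewrite /= inE andbT -subr_eq0 opprK; apply: contraNneq F2 => F20.
  by rewrite inE /= mulr2n F20.
apply: mxminpoly_min; rewrite big_cons big_seq1 rmorphM /=.
rewrite !rmorphB /= !horner_mx_X !horner_mx_C rmorphN rmorph1 opprK.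
by rewrite mulrDr mulr1 mulrBl mul1r -[A * A]/(A *m A) AA addrC subrKA subrr.
Qed.

(** In a common diagonalizing basis, an involution is determined by the set of
indices where its diagonal entry is 1 rather than -1. *)
Lemma commuting_involutions_bound m (As : seq 'M[F]_m) :
    uniq As -> {in As, forall A, A *m A = 1%:M} ->
    {in As &, forall A B, A *m B = B *m A} ->
  (size As <= 2 ^ m)%N.
Proof.
move=> As_uniq As_inv As_comm.
have [P Pu /allP /= Pdiag] : codiagonalizable As.
  apply/codiagonalizableP; split=> [A B AAs BAs|A AAs]; first exact: As_comm.
  exact/involution_diagonalizable/As_inv.
pose D A := P *m A *m invmx P.
have Dinj : injective D.
  by move=> A B /(can_inj (mulmxKV Pu))/(can_inj (mulKmx Pu)).
have Doff A i j : A \in As -> i != j -> D A i j = 0.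
  by move=> /Pdiag /(diagonalizable_forP _ Pu); apply.
have Dsqr A i : A \in As -> D A i i = 1 \/ D A i i = -1.
  move=> AAs; have : (D A *m D A) i i = 1.
    by rewrite /D !mulmxA mulmxKV // -(mulmxA P) As_inv // mulmx1 mulmxV // mxE eqxx.
  rewrite mxE (bigD1 i) //= big1 => [|j ji]; last by rewrite Doff ?mul0r // eq_sym.
  by rewrite addr0 -expr2 => /eqP; rewrite sqrf_eq1 => /orP[] /eqP; [left|right].
pose g A := [ffun i => D A i i == 1].
have g_inj : {in As &, injective g}.
  move=> A B AAs BAs /ffunP gAB; apply/Dinj/matrixP=> i j.
  have [<-|ij] := eqVneq i j; last by rewrite !Doff.
  have := gAB i; rewrite !ffunE.
  case: (Dsqr A i AAs) (Dsqr B i BAs) => -> [] -> //; rewrite eqxx.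
    by move=> /esym/eqP.
  by move=> /eqP.
have /card_uniqP gAs : uniq (map g As) by rewrite (map_inj_in_uniq g_inj).
rewrite -(size_map g) -gAs (leq_trans (max_card _)) //.
by rewrite card_ffun card_bool card_ord.
Qed.

End CommutingInvolutions.

(** * Evaluation of Laurent polynomials *)

Section LaurentMorphisms.
Local Open Scope ring_scope.
Variables (R : idomainType) (S : comUnitRingType).

Local Notation L := (laurent R).
Local Notation t := (laurentX R).

(** Constants and t generate the Laurent polynomials as a ring with t inverted. *)
Lemma laurent_rmorph_ext (f g : {rmorphism L -> S}) :
  (forall a, f (laurentC R a) = g (laurentC R a)) -> f t = g t -> f =1 g.
Proof.
move=> fgC fgX x.
have fgp p : f (laurent_poly p) = g (laurent_poly p).
  elim/poly_ind: p => [|p a IHp]; first by rewrite !rmorph0.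
  by rewrite !rmorphD !rmorphM /= IHp -!/(laurentX R) fgX -!/(laurentC R a) fgC.
have /(congr1 f) := laurent_numE x; have /(congr1 g) := laurent_numE x.
rewrite !rmorphM !rmorphXn fgp fgX => <- /mulIr; apply.
by rewrite unitrX // rmorph_unit // laurentX_unit.
Qed.

Variables (c : {rmorphism R -> S}) (u : S).
Hypothesis uU : u \is a GRing.unit.

Local Notation ev p := (map_poly c p).[u].

Let evXn k : ev 'X^k = u ^+ k.
Proof. by rewrite map_polyXn hornerXn. Qed.

Let evM p q : ev (p * q) = ev p * ev q.
Proof. by rewrite rmorphM hornerM. Qed.

Let evB p q : ev (p - q) = ev p - ev q.
Proof. by rewrite rmorphB hornerD hornerN. Qed.

Definition laurent_eval (x : L) : S := ev (laurent_num x) / u ^+ laurent_exp x.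

Lemma laurent_evalE x p k : x * t ^+ k = laurent_poly p ->
  laurent_eval x = ev p / u ^+ k.
Proof.
move=> xE; apply: (mulIr (unitrX (laurent_exp x) uU)).
apply: (mulIr (unitrX k uU)).
rewrite /laurent_eval divrK ?unitrX // mulrAC divrK ?unitrX //.
rewrite -!evXn -!evM.
congr (ev _); apply: laurent_poly_inj.
by rewrite !laurent_polyM !laurent_polyXn -xE -laurent_numE mulrAC.
Qed.

Lemma laurent_eval_poly p : laurent_eval (laurent_poly p) = ev p.
Proof. by rewrite (@laurent_evalE _ p 0) ?mulr1 // divr1. Qed.

Lemma laurent_evalP x : exists p k, x * t ^+ k = laurent_poly p /\
  laurent_eval x * u ^+ k = ev p.
Proof.
exists (laurent_num x), (laurent_exp x); split; first exact: laurent_numE.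
by rewrite /laurent_eval divrK ?unitrX.
Qed.

Lemma laurent_eval_zmod : zmod_morphism laurent_eval.
Proof.
move=> x y; have [p [k [xE xe]]] := laurent_evalP x.
have [q [l [yE ye]]] := laurent_evalP y.
apply: (mulIr (unitrX (k + l) uU)).
rewrite (@laurent_evalE _ (p * 'X^l - q * 'X^k) (k + l)); last first.
  rewrite laurent_polyB !laurent_polyM !laurent_polyXn -xE -yE.
  by rewrite mulrBl exprD -!mulrA [t ^+ l * _]mulrC.
rewrite divrK ?unitrX // evB !evM !evXn -xe -ye exprD mulrBl mulrA.
by rewrite -!mulrA [u ^+ l * _]mulrC.
Qed.

Lemma laurent_eval_monoid : GRing.monoid_morphism laurent_eval.
Proof.
split=> [|x y].
  by rewrite -(rmorph1 (@laurent_poly R)) laurent_eval_poly rmorph1 hornerC.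
have [p [k [xE xe]]] := laurent_evalP x.
have [q [l [yE ye]]] := laurent_evalP y.
apply: (mulIr (unitrX (k + l) uU)).
rewrite (@laurent_evalE _ (p * q) (k + l)); last first.
  by rewrite laurent_polyM -xE -yE exprD mulrACA.
by rewrite divrK ?unitrX // evM -xe -ye exprD mulrACA.
Qed.

Definition laurent_eval_rmorphism : {rmorphism L -> S} :=
  HB.pack laurent_eval
    (GRing.isZmodMorphism.Build L S laurent_eval laurent_eval_zmod)
    (GRing.isMonoidMorphism.Build L S laurent_eval laurent_eval_monoid).

End LaurentMorphisms.

(** * The 2-group of unipotent permutations *)

Section UnipotentPermutations.
Local Open Scope ring_scope.
Variables (R : finComUnitRingType) (m : nat) (s : R) (N : nat).
Hypotheses (R2 : 1 + 1 = 0 :> R) (sN : s ^+ N = 0).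

Local Notation V := 'rV[R]_m.

(** The i-th step of the s-adic filtration of the row vectors. *)
Definition adic (i : nat) (v : V) := exists w, v = s ^+ i *: w.

Lemma adicD i u v : adic i u -> adic i v -> adic i (u + v).
Proof. by move=> [a ->] [b ->]; exists (a + b); rewrite scalerDr. Qed.

Lemma adic_le i j v : (i <= j)%N -> adic j v -> adic i v.
Proof.
by move=> ij [w ->]; exists (s ^+ (j - i) *: w); rewrite scalerA -exprD subnKC.
Qed.

Lemma adic_eq0 i v : (N <= i)%N -> adic i v -> v = 0.
Proof. by move=> Ni /(adic_le Ni)[w ->]; rewrite sN scale0r. Qed.

(** Additive maps p such that p - 1 raises the filtration by k. *)
Definition unipotent k (p : V -> V) :=
  {morph p : u v / u + v} /\ forall i v, adic i v -> adic (k + i) (p v - v).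

Lemma unipotent_adic k p i v : unipotent k p -> adic i v -> adic i (p v).
Proof.
move=> [_ pk] vi; rewrite -(subrK v (p v)); apply: (adicD _ vi).
by apply: adic_le (pk _ _ vi); rewrite leq_addl.
Qed.

(** If p(w) = 0 then w = - (p(w) - w) lies one step deeper than before, hence in
every step of the filtration. *)
Lemma unipotent_inj p : unipotent 1 p -> injective p.
Proof.
move=> [pD p1] u v uv; apply/eqP; rewrite -subr_eq0; apply/eqP.
suff: adic N (u - v) by apply: adic_eq0.
have p_uv : p (u - v) = 0.
  by apply: (addIr (p v)); rewrite -pD subrK uv add0r.
elim: N => [|i IHi]; first by exists (u - v); rewrite expr0 scale1r.
have [w] := p1 _ _ IHi; rewrite p_uv sub0r => /(congr1 -%R).
by rewrite opprK => ->; exists (- w); rewrite scalerN.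
Qed.

(** With d = p - 1, p^2 - 1 = d^2 + 2 d = d^2. *)
Lemma unipotent_sqr k p : unipotent k p -> unipotent (k + k) (p \o p).
Proof.
move=> [pD pk]; split=> [u v|i v vi] /=; first by rewrite !pD.
have pvE : p v = v + (p v - v) by rewrite addrC subrK.
set d := p v - v in pvE; have di : adic (k + i) d := pk _ _ vi.
have -> : p (p v) - v = p d - d + (d + d).
  by rewrite {1}pvE pD addrA subrK {1}pvE addrAC [v + d + _]addrAC subrr add0r addrC.
have -> : d + d = 0 by rewrite -mulr2n -scaler_nat mulr2n R2 scale0r.
by rewrite addr0 -addnA; apply: pk.
Qed.

Lemma unipotent_perm_sqr j (p : {perm V}) : unipotent 1 p ->
  unipotent (2 ^ j) (p ^+ (2 ^ j))%g.
Proof.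
move=> p1; elim: j => [|j IHj]; first by rewrite expg1.
rewrite expnS mul2n -addnn expgnDr; move: (unipotent_sqr IHj) => [qD qk].
by split=> [u v|i v vi]; rewrite !permM; [apply: qD | apply: qk].
Qed.

Definition unipotent_perms := [set p : {perm V} | `[< unipotent 1 p >]].

Lemma unipotent_perms_group : group_set unipotent_perms.
Proof.
apply/group_setP; split=> [|p q].
  rewrite inE; apply/asboolP; split=> [u v|i v vi]; first by rewrite !perm1.
  by rewrite perm1 subrr; exists 0; rewrite scaler0.
rewrite !inE => /asboolP p1 /asboolP q1; apply/asboolP; split=> [u v|i v vi].
  by rewrite !permM p1.1 q1.1.
rewrite permM -(subrKA (p v)); apply: adicD; last exact: p1.2.
exact: q1.2 (unipotent_adic p1 vi).
Qed.

Canonical unipotent_perm_group := Group unipotent_perms_group.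

(** For p in this group, p^(2^N) - 1 raises the filtration by 2^N >= N, so it
vanishes; hence an element of prime order has order 2, and Cauchy's theorem
concludes. *)
Lemma unipotent_perms_pgroup : (2.-group unipotent_perms)%g.
Proof.
apply/pnatP=> [|q q_pr q_dvd]; first exact: cardG_gt0.
have [p] := Cauchy q_pr q_dvd; rewrite inE => /asboolP p1 op.
rewrite inE; have : (#[p]%g %| 2 ^ N)%N.
  rewrite order_dvdn; apply/eqP/permP=> v; rewrite perm1.
  have [_ pN] := unipotent_perm_sqr N p1.
  apply/eqP; rewrite -subr_eq0; apply/eqP.
  apply: (@adic_eq0 (2 ^ N + 0)); first by rewrite addn0 ltnW // ltn_expl.
  by apply: pN; exists v; rewrite expr0 scale1r.
by rewrite op Euclid_dvdX // dvdn_prime2 // => /andP[].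
Qed.

End UnipotentPermutations.

Section MatrixPermutations.
Local Open Scope ring_scope.
Variables (R : finComUnitRingType) (m : nat).

Definition GL_perm (A : GL m R) : {perm 'rV[R]_m} :=
  perm (can_inj (mulmxK (Defs.GL_unit A))).

(** Matrices act on rows from the right, in agreement with the composition order
of permutations. *)
Lemma GL_permM : {morph GL_perm : A B / (A * B)%g}.
Proof. by move=> A B; apply/permP=> v; rewrite permM !permE /= mulmxA. Qed.

HB.instance Definition _ := isMultiplicative.Build (GL m R) _ GL_perm GL_permM.

Lemma GL_perm_inj : injective GL_perm.
Proof.
move=> A B AB; apply/val_inj/row_matrixP=> i; rewrite !rowE.
by have /permP/(_ (delta_mx 0 i)) := AB; rewrite !permE.
Qed.

Lemma GL_perm_unipotent s (A : GL m R) B :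
  GL_val A = 1%:M + s *: B -> GL_perm A \in unipotent_perms m s.
Proof.
move=> AE; rewrite inE; apply/asboolP; split=> [u v|i v [w ->]].
  by rewrite !permE mulmxDl.
rewrite permE AE mulmxDr mulmx1 addrAC subrr add0r.
by exists (w *m B); rewrite -scalemxAr -scalemxAl scalerA exprD.
Qed.

End MatrixPermutations.

Section SemilinearPermutation.
Local Open Scope ring_scope.
Variables (R : finComUnitRingType) (m : nat) (s : R) (N : nat).
Hypotheses (R2 : 1 + 1 = 0 :> R) (sN : s ^+ N = 0).
Variables (f : {rmorphism R -> R}) (e : R) (d : R -> R).
Hypotheses (fs : f s = s + s ^+ 2 * e) (fd : forall x, f x = x + s * d x).

(** f(s)^i = s^i modulo s^(i+1), by induction on i from the hypothesis fs, and f
is the identity modulo s on the remaining coefficients. *)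
Lemma map_mx_unipotent : unipotent s 1 (map_mx f : 'rV_m -> 'rV_m).
Proof.
split=> [u v|i v [w ->]]; first exact: map_mxD.
have [b bE] : exists b, f s ^+ i = s ^+ i + s ^+ i.+1 * b.
  elim: i => [|i [b IHi]]; first by exists 0; rewrite mulr0 addr0.
  exists (b + e + s * e * b); rewrite exprSr IHi fs !exprS.
  rewrite expr0; ring.
exists (map_mx d w + b *: map_mx f w); rewrite map_mxZ /= rmorphXn /= bE.
apply/rowP=> j; rewrite !mxE fd !exprS; ring.
Qed.

Definition map_mx_perm : {perm 'rV[R]_m} := perm (unipotent_inj sN map_mx_unipotent).

Lemma map_mx_perm_unipotent : map_mx_perm \in unipotent_perms m s.
Proof.
rewrite inE; apply/asboolP; have [fD f1] := map_mx_unipotent.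
by split=> [u v|i v vi]; rewrite !permE; [apply: fD | apply: f1].
Qed.

(** f(v A) = f(v) f(A). The inverse appears because tau g tau^-1 is read from left
to right as a composite of permutations. *)
Lemma map_mx_perm_conj (A B : GL m R) : GL_val B = map_mx f (GL_val A) ->
  (map_mx_perm^-1 * GL_perm A = GL_perm B * map_mx_perm^-1)%g.
Proof.
move=> BE; apply: (mulgI map_mx_perm); rewrite mulVKg; apply: (mulIg map_mx_perm).
rewrite -!mulgA mulVg mulg1; apply/permP=> v; rewrite !permM !permE /= map_mxM.
by rewrite BE.
Qed.

End SemilinearPermutation.

(** * The ring F_2[X]/(X^N - 1) *)

Section CyclicQuotient.
Local Open Scope ring_scope.
Variable k : nat.

Local Notation N := (2 ^ k.+1)%N.
Local Notation h := ('X^N - 1 : {poly 'F_2}).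

(** N = 2^(k+1), so N is even and X^N - 1 = (X - 1)^N. *)
Definition cyclic_quotient : finComUnitRingType := {poly %/ h}.

Local Notation Q := cyclic_quotient.

Definition cyclic_proj : {rmorphism {poly 'F_2} -> Q} := in_qpoly h.

Local Notation pr := cyclic_proj.
Local Notation u := (pr 'X).
Local Notation s := (pr ('X - 1)).

Let N1 : (1 < N)%N.
Proof. by rewrite -{1}(expn0 2) ltn_exp2l. Qed.

Let size_h : size h = N.+1.
Proof. by rewrite size_XnsubC // ltnW. Qed.

Let mk_h : mk_monic h = h.
Proof. by rewrite /mk_monic size_h ltnS ltnW // monicXnsubC // ltnW. Qed.

Let h_monic : h \is monic.
Proof. by rewrite monicXnsubC // ltnW. Qed.

Lemma cyclic_proj_mod p : pr p = p %% h :> {poly 'F_2}.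
Proof. by rewrite Pdiv.IdomainMonic.modpE // -[in RHS]mk_h. Qed.

Lemma cyclic_proj_eq0 p : h %| p -> pr p = 0.
Proof.
by rewrite dvdpE => /eqP ph; apply: val_inj; rewrite /= mk_h.
Qed.

Lemma cyclic_projK (x : Q) : pr (x : {poly 'F_2}) = x.
Proof.
apply: val_inj; rewrite [LHS]cyclic_proj_mod modp_small //.
by have := size_mk_monic x; rewrite [X in (_ < size (polyseq X))%N]mk_h.
Qed.

Lemma cyclic_proj_small (p : {poly 'F_2}) : p != 0 -> (size p <= N)%N -> pr p != 0.
Proof.
move=> p0 pN; apply: contraNneq p0 => /(congr1 (fun x : Q => x : {poly _})).
by rewrite cyclic_proj_mod modp_small ?size_h // => ->.
Qed.

Lemma poly2_char2 : 1 + 1 = 0 :> {poly 'F_2}.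
Proof. by rewrite -polyC1 -polyCD; congr (_%:P); apply: val_inj. Qed.

Lemma cyclic_char2 : 1 + 1 = 0 :> Q.
Proof. by rewrite -(rmorph1 pr) -rmorphD poly2_char2 rmorph0. Qed.

Lemma cyclic_genX : u ^+ N = 1.
Proof.
by apply/eqP; rewrite -subr_eq0 -rmorphXn -(rmorph1 pr) -rmorphB cyclic_proj_eq0.
Qed.

Lemma cyclic_gen_unit : u \is a GRing.unit.
Proof.
apply/unitrPr; exists (u ^+ N.-1).
by rewrite -exprS prednK ?cyclic_genX // ltnW.
Qed.

Lemma poly2_subX2 (p : {poly 'F_2}) : p ^+ 2 - 1 = (p - 1) ^+ 2.
Proof.
have -> : (p - 1) ^+ 2 = p ^+ 2 - (1 + 1) * p + 1 by ring.
have -> : p ^+ 2 - 1 = p ^+ 2 + 1 - (1 + 1) by ring.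
by rewrite poly2_char2 mul0r !subr0.
Qed.

Lemma cyclic_nilpotent : s ^+ N = 0.
Proof.
rewrite -rmorphXn cyclic_proj_eq0 //.
suff -> i : ('X - 1 : {poly 'F_2}) ^+ (2 ^ i) = 'X^(2 ^ i) - 1 by apply: dvdpp.
elim: i => [|i IHi]; first by rewrite !expr1.
by rewrite expnSr exprM IHi -poly2_subX2 -exprM.
Qed.

Let const : {rmorphism 'F_2 -> Q} := qpolyC h.

Definition laurent_cyclic : {rmorphism laurent 'F_2 -> Q} :=
  laurent_eval_rmorphism const cyclic_gen_unit.

Local Notation phi := laurent_cyclic.

Lemma laurent_cyclic_poly p : phi (laurent_poly p) = pr p.
Proof.
rewrite /= (laurent_eval_poly const cyclic_gen_unit); elim/poly_ind: p => [|p a IHp].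
  by rewrite !rmorph0 horner0.
rewrite !rmorphD !rmorphM /= map_polyX map_polyC hornerD hornerM hornerX hornerC IHp.
congr (_ + _); apply: val_inj; rewrite [RHS]cyclic_proj_mod modp_small //.
by rewrite size_h size_polyC ltnS (leq_trans (leq_b1 _)) // ltnW.
Qed.

Variables (a : nat) (a_odd : odd a).

Definition cyclic_subst (x : Q) : Q := pr ((x : {poly _}) \Po 'X^a).

Local Notation f := cyclic_subst.

(** X^N - 1 divides X^(a N) - 1, so the substitution X -> X^a preserves the ideal
generated by X^N - 1. *)
Lemma cyclic_subst_proj p : f (pr p) = pr (p \Po 'X^a).
Proof.
apply/eqP; rewrite -subr_eq0 -rmorphB -comp_polyB; apply/eqP/cyclic_proj_eq0.
have : h %| (pr p : {poly _}) - p.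
  by rewrite cyclic_proj_mod {2}(divp_eq p h) opprD addrCA subrr addr0 -mulNr dvdp_mull.
move=> /dvdpP[q ->]; rewrite comp_polyM dvdp_mull //.
rewrite comp_polyB comp_Xn_poly comp_polyC polyC1 -exprM mulnC exprM -{2}(expr1n _ a).
by rewrite subrXX dvdp_mulr.
Qed.

Lemma cyclic_subst_zmod : zmod_morphism f.
Proof.
move=> x y; rewrite -[x]cyclic_projK -[y]cyclic_projK -rmorphB !cyclic_subst_proj.
by rewrite comp_polyB rmorphB.
Qed.

Lemma cyclic_subst_monoid : GRing.monoid_morphism f.
Proof.
split=> [|x y].
  by rewrite -(rmorph1 pr) cyclic_subst_proj comp_polyC.
rewrite -[x]cyclic_projK -[y]cyclic_projK -rmorphM !cyclic_subst_proj.
by rewrite comp_polyM rmorphM.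
Qed.

HB.instance Definition _ := GRing.isZmodMorphism.Build Q Q f cyclic_subst_zmod.
HB.instance Definition _ := GRing.isMonoidMorphism.Build Q Q f cyclic_subst_monoid.

(** For odd a = 2 b + 1, f(s) - s is the class of X^a - X = X (X^b - 1)^2, and
X - 1 divides X^b - 1. This is where the parity of a matters. *)
Lemma cyclic_subst_ramified : exists e, f s = s + s ^+ 2 * e.
Proof.
have /dvdpP[q qE] : ('X - 1 : {poly 'F_2}) %| 'X^(a./2) - 1.
  by rewrite -{2}(expr1n _ a./2) subrXX dvdp_mulr.
exists (pr (q ^+ 2 * 'X)); rewrite cyclic_subst_proj -rmorphXn -rmorphM -rmorphD.
congr (pr _); rewrite comp_polyB comp_polyX comp_polyC.
rewrite -{1}(odd_double_half a) a_odd -muln2 exprD exprM expr1.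
have -> : ('X - 1) ^+ 2 * (q ^+ 2 * 'X) = (q * ('X - 1)) ^+ 2 * 'X :> {poly 'F_2}.
  by ring.
by rewrite -qE -poly2_subX2; ring.
Qed.

(** The polynomial x(X^a) - x(X) vanishes at 1. *)
Lemma cyclic_subst_inertia : exists d, forall x, f x = x + s * d x.
Proof.
exists (fun x : Q => pr ((((x : {poly _}) \Po 'X^a) - x) %/ ('X - 1))) => x.
rewrite -{2}[x]cyclic_projK -rmorphM -rmorphD; congr (pr _).
rewrite mulrC divpK; first by rewrite [RHS]addrC subrK.
by rewrite dvdp_XsubCl rootE !hornerE horner_comp hornerXn expr1n subrr.
Qed.

(** Both sides are ring morphisms on Laurent polynomials, agreeing on constants
and on t. *)
Lemma cyclic_subst_laurent (n : int) : u ^ n = u ^+ a ->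
  forall x, f (phi x) = phi (laurent_subst n x).
Proof.
move=> una; apply: (@laurent_rmorph_ext _ _ (f \o phi) (phi \o laurent_subst n)).
  move=> b; rewrite -[laurentC _ b]/(laurent_poly b%:P).
  transitivity (f (phi (laurent_poly b%:P))); first by [].
  transitivity (phi (laurent_subst n (laurent_poly b%:P))); last by [].
  rewrite laurent_subst_poly poly_substC -[laurentC _ b]/(laurent_poly b%:P).
  by rewrite laurent_cyclic_poly cyclic_subst_proj comp_polyC.
transitivity (f (phi (laurentX _))); first by [].
transitivity (phi (laurent_subst n (laurentX _))); last by [].
rewrite laurent_substX rmorphXz ?laurentX_unit // laurent_cyclic_poly una.
by rewrite cyclic_subst_proj comp_polyX rmorphXn.
Qed.

End CyclicQuotient.

(** For negative n take a = - n (N - 1), which is congruent to n modulo N and odd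
because N is even. *)
Lemma cyclic_odd_exponent k (n : int) : odd `|n|%N ->
  exists2 a, odd a & (cyclic_proj k 'X ^ n = cyclic_proj k 'X ^+ a)%R.
Proof.
set u := cyclic_proj k _; have uN : (u ^+ (2 ^ k.+1) = 1)%R := cyclic_genX k.
case: n => m odd_m; first by exists m.
exists (m.+1 * (2 ^ k.+1).-1)%N.
  by rewrite oddM [odd m.+1]odd_m -subn1 oddB ?expn_gt0 // oddX.
have uU : (u \is a GRing.unit)%R by apply: cyclic_gen_unit.
apply: (mulrI (unitrX m.+1 uU)).
rewrite -[(u ^ Negz m)%R]/(u ^- m.+1)%R divrr ?unitrX //.
rewrite -exprD -mulnS prednK ?expn_gt0 //.
by rewrite mulnC exprM uN expr1n.
Qed.

(** * Finite 2-quotients of H *)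

Section FiniteQuotients.
Local Open Scope ring_scope.
Variables (k : nat) (n : int).
Hypothesis n_odd : odd `|n|%N.

Local Notation Q := (cyclic_quotient k).
Local Notation u := (cyclic_proj k 'X).
Local Notation s := (cyclic_proj k ('X - 1)).
Local Notation phi := (laurent_cyclic k).
Local Notation U := (unipotent_perm_group 3 s).
Local Notation reduce x := (GL_perm (GL_map phi x)).

(** c = 1 + (1 + t) J with J the all-one matrix and d = 1 + (1 + t) E with E the
first diagonal matrix unit, where 1 + t reduces to s. *)
Lemma reduce_gen_unipotent x : x \in gen cd_gen -> reduce x \in U.
Proof.
pose K x := reduce x \in U.
have sE : s = 1 + u.
  by rewrite rmorphB rmorph1 -[LHS]addr0 -(cyclic_char2 k); ring.
have phiX : phi (laurentX _) = u := laurent_cyclic_poly k 'X.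
apply: (gen_ind (K := K)) => [|x1 x2 Kx1 Kx2|_ [] ->]; rewrite /K.
- by rewrite gmulf1 multiplicative1 group1.
- by rewrite gmulfF gmulfM multiplicativeV groupM ?groupV.
- apply: (@GL_perm_unipotent _ _ _ _ (const_mx 1)).
  by rewrite [LHS](map_c_mx phi) phiX (c_mxE (cyclic_char2 k)) addrC sE.
- apply: (@GL_perm_unipotent _ _ _ _ (delta_mx 0 0)).
  rewrite [LHS](map_d_mx phi) phiX d_mxE sE; apply/matrixP=> i j; rewrite !mxE.
  have [<-|ij] := eqVneq i j; rewrite ?mulr1n ?mulr0n ?add0r; last first.
    have [i0|_] := eqVneq i 0; last by rewrite mulr0.
    have [j0|_] := eqVneq j 0; last by rewrite mulr0.
    by rewrite i0 j0 eqxx in ij.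
  case: eqP => _; last by rewrite mulr0 addr0.
  by rewrite mulr1 addrA cyclic_char2 add0r.
Qed.

(** The letter tau goes to the inverse of the permutation induced by X -> X^n. *)
Lemma finite_quotient (g : groupG) : GL_map phi (\val g) <> 1%g ->
  exists (K : finGroupType) (h : {multiplicative groupH n -> K}),
    (2.-group [set: K])%g /\ h (hnn_base (rho n) g) <> 1%g.
Proof.
move=> g1; have [a a_odd una] := cyclic_odd_exponent k n_odd.
have [e fs] := cyclic_subst_ramified k a_odd.
have [d fd] := cyclic_subst_inertia k a.
pose sigma := map_mx_perm 3 (cyclic_nilpotent k) fs fd.
have sigmaU : (sigma^-1)%g \in U by rewrite groupV map_mx_perm_unipotent.
pose rd (x : groupG) := reduce (\val x).
have rdU x : rd x \in U by apply/reduce_gen_unipotent/valP.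
pose psi x := subg U (rd x).
have psiM : {morph psi : x y / (x * y)%g}.
  by move=> x y; rewrite /psi -subgM ?rdU // /rd !gmulfM.
pose Psi : {multiplicative groupG -> _} :=
  HB.pack psi (isMultiplicative.Build _ _ psi psiM).
have psi_conj x :
    (subg U sigma^-1%g * Psi x = Psi (rho n x) * subg U sigma^-1%g)%g.
  transitivity (subg U (sigma^-1 * rd x)%g).
    by rewrite (subgM sigmaU (rdU x)).
  transitivity (subg U (rd (rho n x) * sigma^-1)%g); last first.
    by rewrite (subgM (rdU _) sigmaU).
  congr (subg _ _); apply: map_mx_perm_conj.
  apply/matrixP=> i j; rewrite !mxE; symmetry.
  exact: cyclic_subst_laurent.
exists (subg_of U), (hnn_lift psi_conj); split.
  rewrite /pgroup -(card_isog (isog_subg U)).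
  exact: unipotent_perms_pgroup (cyclic_char2 k) (cyclic_nilpotent k).
rewrite hnn_lift_base => /(congr1 val); rewrite [LHS](@subgK _ _ _ (rdU g)) => rd1.
by apply: g1; apply: GL_perm_inj; rewrite multiplicative1.
Qed.

End FiniteQuotients.

Section Separation.
Local Open Scope ring_scope.

(** Clear the denominator of x: a nonzero polynomial of degree less than N is not
a multiple of X^N - 1. *)
Lemma laurent_separated (x : laurent 'F_2) : x != 0 ->
  exists k, laurent_cyclic k x != 0.
Proof.
move=> x0; pose p := laurent_num x; exists (size p).
have p0 : p != 0.
  apply: contraNneq x0 => p0; apply/eqP.
  apply: (mulIr (unitrX (laurent_exp x) (laurentX_unit _))).
  by rewrite laurent_numE -/p p0 rmorph0 mul0r.
have : laurent_cyclic (size p) (laurent_poly p) != 0.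
  rewrite laurent_cyclic_poly cyclic_proj_small //.
  by rewrite (leq_trans _ (ltnW (ltn_expl (size p).+1 (ltnSn 1)))).
by apply: contraNneq => x_0; rewrite -laurent_numE rmorphM x_0 mul0r.
Qed.

Lemma GL_separated m (A : GL m (laurent 'F_2)) : A <> 1%g ->
  exists k, GL_map (laurent_cyclic k) A <> 1%g.
Proof.
move=> A1; have [i [j ij]] : exists i j, GL_val A i j - (1%:M : 'M_m) i j != 0.
  apply: contra_notP A1 => Aij; apply/val_inj/matrixP=> i j; apply/eqP.
  by rewrite -subr_eq0; apply: contra_notT Aij => ?; exists i, j.
have [k kij] := laurent_separated ij; exists k => /(congr1 val)/matrixP/(_ i j).
rewrite !mxE => Aij.
by move/eqP: kij; apply; rewrite rmorphB Aij mxE rmorph_nat subrr.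
Qed.

Variable n : int.
Hypothesis n_odd : odd `|n|%N.
Local Open Scope group_scope.

Lemma base_residual (g : groupG) : g <> 1 ->
  exists (K : finGroupType) (h : {multiplicative groupH n -> K}),
    2.-group [set: K] /\ h (hnn_base (rho n) g) <> 1.
Proof.
move=> g1; have [k gk] : exists k, GL_map (laurent_cyclic k) (\val g) <> 1.
  by apply: GL_separated => g_1; apply/g1/val_inj.
exact: finite_quotient gk.
Qed.

Lemma base_inj : injective (hnn_base (rho n)).
Proof.
move=> g g' gg'; apply: divg1_eq.
have [//|/base_residual[K [h [_]]]] := pselect (g * g'^-1 = 1).
case; have -> : hnn_base (rho n) (g * g'^-1) = 1.
  by rewrite hnn_baseM (multiplicativeV (hnn_base (rho n))) /= gg' mulgV.
exact: multiplicative1.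
Qed.

End Separation.

(** * Triangular form and derived series of G *)

Section TriangularForm.
Local Open Scope ring_scope.
Variable S : comUnitRingType.
Hypothesis S2 : 1 + 1 = 0 :> S.

(** The matrix with rows (1,a,b), (0,v,e), (0,0,1) in the basis (0,1,1), (1,0,0),
(0,1,0), written in the standard basis; in characteristic 2 the third standard
vector is the sum of the first and third vectors of this basis. *)
Definition tri_mx (a b e v : S) : 'M[S]_3 :=
  \matrix_(i, j)
    if i == 0 then if j == 0 then v else e
    else if j == 0 then a else (i == j)%:R + b.

Lemma tri_mxM a b e v a' b' e' v' :
  tri_mx a b e v *m tri_mx a' b' e' v' =
  tri_mx (a * v' + a') (b + b' + a * e') (v * e' + e) (v * v').
Proof.
(* Every entry of the two matrices agrees up to an explicit multiple of 2. *)
have mod2 (x y z : S) : x = y + (1 + 1) * z -> x = y by rewrite S2 mul0r addr0.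
apply/matrixP=> i j; rewrite mxE !big_ord_recl big_ord0 !mxE.
case: i => [[|[|[|//]]] ?]; case: j => [[|[|[|//]]] ?] /=; rewrite ?mulr1n ?mulr0n.
- by apply: (mod2 _ _ (e * a')); ring.
- by apply: (mod2 _ _ (e * b')); ring.
- by apply: (mod2 _ _ (e * b')); ring.
- by apply: (mod2 _ _ (b * a')); ring.
- by apply: (mod2 _ _ (b * b')); ring.
- by apply: (mod2 _ _ (b * b')); ring.
- by apply: (mod2 _ _ (b * a')); ring.
- by apply: (mod2 _ _ (b * b')); ring.
- by apply: (mod2 _ _ (b * b')); ring.
Qed.

Lemma tri_mx_inj a b e v a' b' e' v' : tri_mx a b e v = tri_mx a' b' e' v' ->
  [/\ a = a', b = b', e = e' & v = v'].
Proof.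
move=> /matrixP E; split.
- by have := E 1 0; rewrite !mxE.
- by have := E 1 (-1); rewrite !mxE /= !add0r.
- by have := E 0 1; rewrite !mxE.
- by have := E 0 0; rewrite !mxE.
Qed.

Lemma tri_mx1 : tri_mx 0 0 0 1 = 1%:M.
Proof.
apply/matrixP=> i j; rewrite !mxE addr0.
by case: i => [[|[|[|//]]] ?]; case: j => [[|[|[|//]]] ?].
Qed.

Lemma tri_mxV (A : GL 3 S) a b e v w : v * w = 1 -> GL_val A = tri_mx a b e v ->
  GL_val A^-1%g = tri_mx (a * w) (b + a * e * w) (e * w) w.
Proof.
move=> vw AE; rewrite GL_valV -[invmx A]mulmx1.
apply: (canLR (mulKmx (Defs.GL_unit A))).
have ss := addxx_char2 S2.
rewrite AE tri_mxM vw [v * (e * w)]mulrCA vw mulr1 !ss addrA ss add0r.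
by rewrite mulrA ss tri_mx1.
Qed.

Lemma c_mx_tri u : c_mx u = tri_mx (1 + u) (1 + u) (1 + u) u.
Proof.
apply/matrixP=> i j; rewrite !mxE.
case: i => [[|[|[|//]]] ?]; case: j => [[|[|[|//]]] ?] //=; rewrite ?add0r //.
  by rewrite addrA S2 add0r.
by rewrite addrA S2 add0r.
Qed.

Lemma d_mx_tri u : d_mx u = tri_mx 0 0 0 u.
Proof.
apply/matrixP=> i j; rewrite !mxE addr0.
by case: i => [[|[|[|//]]] ?]; case: j => [[|[|[|//]]] ?].
Qed.

End TriangularForm.

Section StructureOfG.
Local Open Scope ring_scope.

Local Notation L := (laurent 'F_2).
Local Notation t := (laurentX 'F_2).
Local Notation char2 := laurent2_char2.

(** Upper bounds for the derived subgroups, in terms of the parameters: unipotent,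
then central in the unipotent matrices, then trivial. *)
Definition derived_shape k (a b e v : L) :=
  [/\ (0 < k)%N -> v = 1, (1 < k)%N -> a = 0 /\ e = 0 & (2 < k)%N -> b = 0].

(** The witness w records that v is invertible, as needed for inverses. *)
Definition in_derived_shape k (x : GL 3 L) :=
  exists a b e v w, [/\ v * w = 1, derived_shape k a b e v &
                        GL_val x = tri_mx a b e v].

Lemma in_derived_shape1 k : in_derived_shape k 1%g.
Proof. by exists 0, 0, 0, 1, 1; split; rewrite ?mulr1 // tri_mx1. Qed.

Lemma in_derived_shapeF k x y :
  in_derived_shape k x -> in_derived_shape k y -> in_derived_shape k (x * y^-1)%g.
Proof.
move=> [a [b [e [v [w [vw [xv xae xb] xE]]]]]].
move=> [a' [b' [e' [v' [w' [vw' [yv yae yb] yE]]]]]].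
exists (a * w' + a' * w'), (b + (b' + a' * e' * w') + a * (e' * w')).
exists (v * (e' * w') + e), (v * w'), (w * v'); split.
- by rewrite mulrACA vw [w' * _]mulrC vw' mulr1.
- split=> k1.
  + by have := vw'; rewrite yv // mul1r => ->; rewrite xv // mulr1.
  + by have [-> ->] := xae k1; have [-> ->] := yae k1; rewrite !mul0r mulr0 !addr0.
  + have [a0 _] := xae (ltnW k1); have [a'0 _] := yae (ltnW k1).
    by rewrite a0 a'0 xb // yb // !mul0r !addr0.
- by rewrite GL_valM xE (tri_mxV char2 vw' yE) (tri_mxM char2).
Qed.

Lemma in_derived_shape_gen x : x \in gen cd_gen -> in_derived_shape 0 x.
Proof.
have tV : t * t^-1 = 1 by rewrite mulrV ?laurentX_unit.
apply: (gen_ind (K := in_derived_shape 0)) => [|x1 x2|_ [] ->].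
- exact: in_derived_shape1.
- exact: in_derived_shapeF.
- by exists (1 + t), (1 + t), (1 + t), t, t^-1; split=> //; apply: c_mx_tri char2 t.
- by exists 0, 0, 0, t, t^-1; split=> //; apply: d_mx_tri.
Qed.

(** Compare the parameters in x y = y x [~ x, y]: the parameter v is
multiplicative, a and e are additive once v = 1, and b is additive once
a = e = 0. *)
Lemma in_derived_shapeR k x y : in_derived_shape 0 [~ x, y]%g ->
  in_derived_shape k x -> in_derived_shape k y -> in_derived_shape k.+1 [~ x, y]%g.
Proof.
move=> [a [b [e [v [w [vw _ zE]]]]]].
move=> [a1 [b1 [e1 [v1 [w1 [vw1 [xv xae xb] xE]]]]]].
move=> [a2 [b2 [e2 [v2 [w2 [vw2 [yv yae yb] yE]]]]]].
exists a, b, e, v, w; split=> //.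
have := commgC x y; move: zE; move: [~ x, y]%g => z zE /(congr1 (@GL_val _ _)).
rewrite !GL_valM xE yE zE !(tri_mxM char2) => /tri_mx_inj[aE bE eE vE].
have ww : (w1 * w2) * (v2 * v1) = 1.
  by rewrite [v2 * v1]mulrC mulrACA [w1 * _]mulrC vw1 [w2 * _]mulrC vw2 mulr1.
have v_1 : v = 1 by rewrite -[v]mul1r -ww -mulrA -vE [v1 * v2]mulrC ww.
split=> // k1.
  have v1_1 := xv k1; have v2_1 := yv k1.
  move: aE eE; rewrite v_1 v1_1 v2_1 !mulr1 !mul1r => aE eE.
  split.
    by apply: (addrI (a2 + a1)); rewrite addr0 -aE addrC.
  by apply: (addIr (e1 + e2)); rewrite add0r -eE addrC.
have [a1_0 e1_0] := xae k1; have [a2_0 e2_0] := yae k1.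
move: bE; rewrite a1_0 a2_0 !(mul0r, addr0) => bE.
by apply: (addrI (b2 + b1)); rewrite addr0 -bE addrC.
Qed.

Lemma groupG_derived3 (g : groupG) : g \in @derived_subgroup groupG 3 -> g = 1%g.
Proof.
move=> g3; have [a [b [e [v [w [_ [v1 ae0 b0] gE]]]]]] : in_derived_shape 3 (\val g).
  apply: (derived_subgroup_sub (P := fun k x => in_derived_shape k (\val x))) g3
    => [x|k|k x y|k x y].
  - exact/in_derived_shape_gen/valP.
  - exact: in_derived_shape1.
  - exact: in_derived_shapeF.
  - by apply: in_derived_shapeR; apply/in_derived_shape_gen/(valP [~ x, y]%g).
apply/val_inj/val_inj; rewrite [LHS]gE v1 // b0 // (ae0 _).1 // (ae0 _).2 //.
exact: tri_mx1.
Qed.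

End StructureOfG.

(** * Generators of G and central involutions *)

Section Generators.
Local Open Scope ring_scope.

Local Notation L := (laurent 'F_2).
Local Notation t := (laurentX 'F_2).
Local Notation char2 := laurent2_char2.

Definition gc : groupG := Subgroup (Defs.mem_gen (or_introl (erefl mat_c))).
Definition gd : groupG := Subgroup (Defs.mem_gen (or_intror (erefl mat_d))).

Local Notation mx g := (GL_val (\val (g : groupG))).

Lemma mx_inj (g h : groupG) : mx g = mx h -> g = h.
Proof. by move=> gh; do 2!apply: val_inj. Qed.

Lemma mxM g h : mx (g * h)%g = mx g *m mx h.
Proof. by []. Qed.

Lemma mx_gcX k : mx (gc ^+ k)%g = c_mx (t ^+ k).
Proof.
elim: k => [|k IHk]; first by rewrite expr0 (c_mx1 char2).
by rewrite expgS exprS mxM IHk (c_mxM char2).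
Qed.

Lemma mx_gdX k : mx (gd ^+ k)%g = tri_mx 0 0 0 (t ^+ k).
Proof.
rewrite -d_mx_tri; elim: k => [|k IHk]; first by rewrite expr0 d_mx1.
by rewrite expgS exprS mxM IHk d_mxM.
Qed.

(** The Heisenberg commutator, again obtained from g h = h g [~ g, h]. *)
Lemma mx_comm (g h : groupG) a b e a' b' e' :
    mx g = tri_mx a b e 1 -> mx h = tri_mx a' b' e' 1 ->
  mx [~ g, h]%g = tri_mx 0 (a * e' + a' * e) 0 1.
Proof.
move=> gE hE; have /(congr1 (fun x : groupG => mx x)) := commgC g h.
rewrite mxM => ghE; apply: (can_inj (mulKmx (Defs.GL_unit (\val (h * g)%g)))).
rewrite -[LHS]ghE !mxM gE hE !(tri_mxM char2) !(mulr1, mul1r, mulr0, addr0, add0r).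
have ss := addxx_char2 char2.
congr tri_mx; [exact: addrC | | exact: addrC].
transitivity (b + b' + a * e' + (a' * e + a' * e)); last by ring.
by rewrite ss addr0.
Qed.

(** The quotient of two elements with the same diagonal entry t. *)
Definition unip_gen : groupG := (gc * gd^-1)%g.
Definition central_comm k : groupG := [~ unip_gen, unip_gen ^ (gd ^+ k)]%g.

Local Notation q := (t^-1).

(** Conjugation by d^k multiplies the parameter a by t^k and e by t^-k. *)
Lemma mx_central_comm k :
  mx (central_comm k) = tri_mx 0 ((1 + t) ^+ 2 * q * (q ^+ k + t ^+ k)) 0 1.
Proof.
have tq : t * q = 1 by rewrite mulrV ?laurentX_unit.
have tqk j : t ^+ j * q ^+ j = 1 by rewrite -exprMn tq expr1n.
have gdE : mx gd = tri_mx 0 0 0 t by rewrite -(mx_gdX 1).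
have [b uE] : exists b, mx unip_gen = tri_mx ((1 + t) * q) b (1 + t) 1.
  exists ((1 + t) + (1 + t) * 0).
  rewrite mxM (tri_mxV char2 tq gdE) [mx gc](c_mx_tri char2) (tri_mxM char2) tq.
  by rewrite !(mul0r, mulr0, addr0, add0r).
rewrite /central_comm; move: unip_gen uE => w uE.
rewrite (mx_comm (a' := (1 + t) * q * t ^+ k) (b' := b)
                 (e' := q ^+ k * (1 + t)) uE).
  congr tri_mx; ring.
rewrite conjgE !mxM (tri_mxV char2 (tqk k) (mx_gdX k)) mx_gdX uE !(tri_mxM char2).
by rewrite !(mul0r, mulr0, addr0, add0r, mulr1) mul1r [X in tri_mx _ _ _ X]mulrC tqk.
Qed.

Lemma central_comm_sqr k : (central_comm k * central_comm k = 1)%g.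
Proof.
apply: mx_inj; rewrite mxM mx_central_comm (tri_mxM char2).
by rewrite !(mul0r, mulr0, addr0, mulr1) addxx_char2 ?char2 // tri_mx1.
Qed.

Lemma central_comm_commute j k : commute (central_comm j) (central_comm k).
Proof.
apply: mx_inj; rewrite (mxM (central_comm j)) (mxM (central_comm k)).
rewrite !mx_central_comm !(tri_mxM char2).
by rewrite !(mul0r, mulr0, addr0, mulr1) addrC.
Qed.

(** Multiplied by t^(j+k+1), the parameter b of the j-th commutator becomes the
polynomial (1 + X)^2 X^k (1 + X^(2 j)). If j < k and the parameters agree, then
X^k (1 + X^(2 j)) = X^j (1 + X^(2 k)), which fails at the coefficient of X^j. *)
Lemma central_comm_inj : injective central_comm.
Proof.
suff H j k : (j < k)%N -> central_comm j <> central_comm k.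
  move=> j k jk; have [jk'|kj'|//] := ltngtP j k; first by case: (H _ _ jk').
  by case: (H _ _ kj').
move=> jk /(congr1 (fun x : groupG => mx x)); rewrite !mx_central_comm.
move=> /tri_mx_inj[_ + _ _].
move=> /(congr1 (fun x => x * (t * t ^+ j * t ^+ k))).
have tq : t * q = 1 by rewrite mulrV ?laurentX_unit.
have tqk i : t ^+ i * q ^+ i = 1 by rewrite -exprMn tq expr1n.
pose p i l : {poly 'F_2} := (1 + 'X) ^+ 2 * ('X^l * (1 + 'X^i * 'X^i)).
have denomE i l : (1 + t) ^+ 2 * q * (q ^+ i + t ^+ i) * (t * t ^+ i * t ^+ l) =
    laurent_poly (p i l).
  rewrite rmorphM rmorphXn rmorphD rmorph1 !rmorphM rmorphD rmorph1 rmorphM.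
  rewrite /= !laurent_polyXn -[laurent_poly (polyX _)]/t.
  transitivity ((1 + t) ^+ 2 * (t * q) *
                (t ^+ l * (t ^+ i * q ^+ i + t ^+ i * t ^+ i))).
    ring.
  by rewrite tq tqk mulr1.
rewrite denomE -[t * t ^+ j * _]mulrA [t ^+ j * _]mulrC [t * _]mulrA denomE.
move=> /laurent_poly_inj/mulfI.
have X1 : (1 + 'X : {poly 'F_2}) ^+ 2 != 0.
  by rewrite expf_neq0 // addrC -polyC1 -size_poly_gt0 size_XaddC.
move=> /(_ X1)/(congr1 (fun p : {poly 'F_2} => p`_j))/eqP.
rewrite !coefXnM jk ltnn subnn coefD coef1 -exprD coefXn.
by rewrite (_ : 0%N == (k + k)%N = false) ?addr0 //; lia.
Qed.

Lemma gc_order k : (0 < k)%N -> (gc ^+ k)%g <> 1%g.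
Proof.
move=> k0 /(congr1 (fun x : groupG => mx x 0 0)); rewrite mx_gcX !mxE /=.
rewrite -laurent_polyXn -(rmorph1 (@laurent_poly _)) => /laurent_poly_inj.
move=> /(congr1 (fun p : {poly _} => size p)); rewrite size_polyXn size_poly1 => -[k_0].
by rewrite k_0 in k0.
Qed.

(** The exponent n^2 is used rather than n to make it positive. *)
Lemma rho_gc2 n : iter 2 (rho n) gc = (gc ^+ (`|n| ^ 2))%g.
Proof.
apply: mx_inj; rewrite mx_gcX.
have -> : mx (iter 2 (rho n) gc) =
    map_mx (laurent_subst n) (map_mx (laurent_subst n) (c_mx t)) by [].
rewrite !map_c_mx /= laurent_substX (rmorphXz (laurent_subst n)) ?laurentX_unit //=.
rewrite laurent_substX exprz_exp -expr2; congr c_mx.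
by rewrite -[RHS]/(t ^ Posz _) -abszX gez0_abs // sqr_ge0.
Qed.

End Generators.

(** * The four properties *)

Section Conclusions.
Variable n : int.
Local Open Scope group_scope.

Local Notation base := (hnn_base (rho n)).

Lemma groupH_finitely_generated : finitely_generated (groupH n).
Proof.
apply: (@hnn_finitely_generated _ (rho n) [:: gc; gd]) => g.
set S := gen _.
pose K (x : GL 3 (laurent 'F_2)) := exists2 h, \val h = x & base h \in S.
have [] : K (\val g); last by move=> h /val_inj ->.
have gG := valP g; move: (\val g) gG; apply: gen_ind.
- by exists 1 => //; rewrite multiplicative1 gpred1.
- move=> x y [x' <- xS] [y' <- yS]; exists (x' * y'^-1) => //.
  by rewrite gmulfM multiplicativeV gpredM ?gpredV.
- by move=> _ [] ->; [exists gc | exists gd] => //; apply: Defs.mem_gen;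
    rewrite !inE eqxx ?orbT.
Qed.

Lemma groupH_solvable : solvable_group (groupH n).
Proof. exact: hnn_solvable groupG_derived3. Qed.

Hypotheses (n_gt1 : (1 < `|n|)%N) (n_odd : odd `|n|%N).

Lemma groupH_residually2 : residually_pgroup (groupH n) 2.
Proof. by apply: hnn_residually_p => // g; apply: base_residual. Qed.

Lemma groupH_not_linear : ~ linear_group (groupH n).
Proof.
move=> [F [m [h h_inj]]]; have [F2|F2] := boolP (2%N \in [pchar F]%R).
  have [||N N0] := @GL_finite_order F m (h (base gc))
    (h (hnn_stable (rho n) ^+ 2)) (`|n| ^ 2) F2.
  - by rewrite -(exp1n 2) ltn_exp2r.
  - by rewrite -multiplicativeX -!gmulfM hnn_conjX rho_gc2 multiplicativeX.
  rewrite -!multiplicativeX -(multiplicative1 h) => /h_inj.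
  rewrite -(multiplicative1 base) => /(base_inj n_odd).
  exact: gc_order.
pose A k := GL_val (h (base (central_comm k))).
have A_inj : injective A.
  by move=> j k /val_inj/h_inj/(base_inj n_odd)/central_comm_inj.
have := @commuting_involutions_bound F F2 m [seq A k | k <- iota 0 (2 ^ m).+1].
rewrite size_map size_iota ltnn => bound; suff: false by [].
apply: bound; first by rewrite map_inj_uniq // iota_uniq.
- move=> _ /mapP[k _ ->]; rewrite -[LHS]/(GL_val (h _ * h _)) -!gmulfM.
  by rewrite central_comm_sqr !multiplicative1.
- move=> _ _ /mapP[j _ ->] /mapP[k _ ->].
  rewrite -[LHS]/(GL_val (h _ * h _)) -[RHS]/(GL_val (h _ * h _)) -!gmulfM.
  by rewrite (central_comm_commute j k).
Qed.

End Conclusions.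

Theorem corollary1p6 (n : int) (hn : (1 < `|n|)%N) (nodd : odd `|n|%N) :
  finitely_generated (groupH n) /\ ~ linear_group (groupH n) /\
  solvable_group (groupH n) /\ residually_pgroup (groupH n) 2.
Proof.
split; first exact: groupH_finitely_generated.
split; first exact: groupH_not_linear hn nodd.
by split; [apply: groupH_solvable | apply: groupH_residually2].
Qed.
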